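(* Let $\alpha,\beta\in(1,2)$, $\Omega=(x_L,x_R)\times(y_L,y_R)$, $\varsigma_\alpha=|\cos(\frac{\alpha}{2}\pi)|$, $\varsigma_\beta=|\cos(\frac{\beta}{2}\pi)|$. Let $d(x,y)=\nu_1a(x,y)$ and $e(x,y)=\nu_2a(x,y)$ for all $(x,y)\in\Omega$, with nonnegative constants $\nu_1,\nu_2$. Assume: (i) $a(x,y)\in[\check a,\hat a]$ with $\check a>0$ for all $(x,y)\in\Omega$. (ii) For any $x\in(x_L,x_R)$, $a(x,\cdot)$ is convex or concave on $(y_L,y_R)$; and for any $y\in(y_L,y_R)$, $a(\cdot,y)$ is convex or concave on $(x_L,x_R)$. (iii) $\check c_1>0$ and $\check c_2>0$, where $$\check c_1=\inf_{y\in(y_L,y_R)}\Big[\tilde{\mathcal M}_1(y)-\tfrac{\sqrt2}{\varsigma_\alpha}\big(\hat{\mathcal M}_1(y)-\check{\mathcal M}_1(y)\big)\Big],\qquad \check c_2=\inf_{x\in(x_L,x_R)}\Big[\tilde{\mathcal M}_2(x)-\tfrac{\sqrt2}{\varsigma_\beta}\big(\hat{\mathcal M}_2(x)-\check{\mathcal M}_2(x)\big)\Big],$$ with $\hat{\mathcal M}_1(y)=\sup_{x\in(x_L,x_R)}a(x,y)$, $\check{\mathcal M}_1(y)=\inf_{x\in(x_L,x_R)}a(x,y)$, $\hat{\mathcal M}_2(x)=\sup_{y\in(y_L,y_R)}a(x,y)$, $\check{\mathcal M}_2(x)=\inf_{y\in(y_L,y_R)}a(x,y)$; $\tilde{\mathcal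 M}_1(y)=\check{\mathcal M}_1(y)$ if $a(\cdot,y)$ is convex and $\tilde{\mathcal M}_1(y)=\hat{\mathcal M}_1(y)$ if $a(\cdot,y)$ is concave; $\tilde{\mathcal M}_2(x)=\check{\mathcal M}_2(x)$ if $a(x,\cdot)$ is convex and $\tilde{\mathcal M}_2(x)=\hat{\mathcal M}_2(x)$ if $a(x,\cdot)$ is concave. Then, for any positive integers $N,M_1,M_2$, $\Sigma^2(\mathbf{A}\mathbf{P}^{-1})\subset[\check s,\hat s]$, and thus $$\sup_{M_1,M_2,N\ge1}\mathrm{cond}(\mathbf{A}\mathbf{P}^{-1})\le\sqrt{\hat s/\check s},$$ where $\check s,\hat s$ are the positive constants, independent of $\tau,h_1,h_2$, $$\check s=\min\left\{\frac{\check c_1}{\hat a},\frac{\check c_2}{\hat a},\frac{\check a^2}{\hat a^2}\right\},\qquad \hat s=\max\left\{\frac{\hat c_1}{\check a},\frac{\hat c_2}{\check a},\frac{\hat a^2}{\check a^2}\right\},$$ $$\hat c_1=\sup_{y\in(y_L,y_R)}\Big[\tilde{\mathcal M}_1(y)+\tfrac{\sqrt2}{\varsigma_\alpha}\big(\hat{\mathcal M}_1(y)-\check{\mathcal M}_1(y)\big)\Big],\qquad \hat c_2=\sup_{x\in(x_L,x_R)}\Big[\tilde{\mathcal M}_2(x)+\tfrac{\sqrt2}{\varsigma_\beta}\big(\hat{\mathcal M}_2(x)-\check{\mathcal M}_2(x)\big)\Big].$$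
   Context: Let $T>0$, $\tau=T/N$, $h_1=\frac{x_R-x_L}{M_1+1}$, $h_2=\frac{y_R-y_L}{M_2+1}$, $x_i=x_L+ih_1$, $y_j=y_L+jh_2$, $\hat M=M_1M_2$. $D$ and $E$ are the $\hat M\times\hat M$ diagonal matrices with diagonal entries $d(x_i,y_j)$ and $e(x_i,y_j)$, $1\le i\le M_1$, $1\le j\le M_2$, ordered with the index $i$ running fastest; $\bar d$ and $\bar e$ are the arithmetic means of the diagonal entries of $D$ and $E$. For $\gamma\in(1,2)$ define $g_0^{(\gamma)}=1$, $g_k^{(\gamma)}=\left(1-\frac{\gamma+1}{k}\right)g_{k-1}^{(\gamma)}$ $(k\ge1)$, $w_0^{(\gamma)}=\frac{\gamma}{2}g_0^{(\gamma)}$, $w_k^{(\gamma)}=\frac{\gamma}{2}g_k^{(\gamma)}+\frac{2-\gamma}{2}g_{k-1}^{(\gamma)}$ $(k\ge1)$. $G_\gamma$ is the Toeplitz matrix with $(i,j)$ entry $w_{i-j+1}^{(\gamma)}$ if $i-j+1\ge0$ and $0$ otherwise; $G_\alpha$ has size $M_1\times M_1$, $G_\beta$ has size $M_2\times M_2$. With $\eta_x=\tau/(2h_1^\alpha)$, $\eta_y=\tau/(2h_2^\beta)$, $I_k$ the $k\times k$ identity and $\otimes$ the Kronecker product, put $B_x=-\eta_x(I_{M_2}\otimes G_\alpha)$, $B_y=-\eta_y(G_\beta\otimes I_{M_1})$, $$\mathbf{A}=I_{\hat M}+DB_x+EB_y,\qquad \mathbf{P}=I_{\hat M}+\bar d\,B_x+\bar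 e\,B_y .$$ $\Sigma(\mathbf{C})$ is the set of singular values of $\mathbf{C}$, $\Sigma^2(\mathbf{C})=\{x^2:x\in\Sigma(\mathbf{C})\}$, and $\mathrm{cond}(\mathbf{C})=\|\mathbf{C}\|_2\|\mathbf{C}^{-1}\|_2$. If a function is both convex and concave, either of the two corresponding values may be used in the definition of $\tilde{\mathcal M}_1$ or $\tilde{\mathcal M}_2$. *)

(* Defs.v *)
From HB Require Import structures.
From mathcomp Require Import all_boot all_order all_algebra.
From mathcomp Require Import all_classical all_reals all_analysis.
From mathcomp Require Export mxtens.

Set Implicit Arguments.
Unset Strict Implicit.
Unset Printing Implicit Defensive.

Import Order.TTheory GRing.Theory Num.Theory.
Import numFieldNormedType.Exports.

Local Open Scope classical_set_scope.
Local Open Scope ring_scope.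

Section SingularValues.
Variables (R : realType) (n : nat).
Implicit Types C : 'M[R]_n.

Definition singular_values C : set R :=
  [set s | 0 <= s /\ eigenvalue (C^T *m C) (s ^+ 2)].

Definition sq_singular_values C : set R :=
  [set s ^+ 2 | s in singular_values C].

Definition l2norm (x : 'cV[R]_n) : R := Num.sqrt (\sum_i x i 0 ^+ 2).

(* The spectral norm; for n = 0 the set is empty and [sup set0 = 0]. *)
Definition mxnorm2 C : R :=
  sup [set l2norm (C *m x) | x in [set x | l2norm x = 1]].

(* [invmx C = C] when C is singular, hence the explicit value +oo there. *)
Definition cond2 C : \bar R :=
  if C \in unitmx then (mxnorm2 C * mxnorm2 (invmx C))%:E else +oo%E.

End SingularValues.

Section Discretization.
Variable R : realType.
Implicit Types (gamma alpha beta eta L U T : R) (f : R -> R -> R).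

Fixpoint g_coef gamma (k : nat) : R :=
  if k is k'.+1 then (1 - (gamma + 1) / k%:R) * g_coef gamma k' else 1.

Definition w_coef gamma (k : nat) : R :=
  if k is k'.+1
  then gamma / 2 * g_coef gamma k + (2 - gamma) / 2 * g_coef gamma k'
  else gamma / 2 * g_coef gamma 0.

(* The condition i - j + 1 >= 0 is written without truncated subtraction. *)
Definition G_mx gamma (M : nat) : 'M[R]_M :=
  \matrix_(i < M, j < M)
    if (j <= i.+1)%N then w_coef gamma (i.+1 - j)%N else 0.

Definition mesh L U (M : nat) : R := (U - L) / M.+1%:R.

Definition node L U (M k : nat) : R := L + k%:R * mesh L U M.

(* Unknowns are numbered by 'I_(M2 * M1) through [mxtens_index (j, i)], whose
   value is j * M1 + i, so that i (the x-direction) runs fastest; ordinals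
   start at 0, so the interior nodes are those of index i.+1 and j.+1. *)
Definition samples (xL xR yL yR : R) (M1 M2 : nat) f : 'rV[R]_(M2 * M1) :=
  \row_k f (node xL xR M1 (mxtens_unindex k).2.+1)
           (node yL yR M2 (mxtens_unindex k).1.+1).

Definition mean (n : nat) (v : 'rV[R]_n) : R := (\sum_k v 0 k) / n%:R.

Definition eta T (N : nat) h gamma : R := (T / N%:R) / (2 * h `^ gamma).

Section Matrices.
Variables (alpha beta xL xR yL yR T : R) (d e : R -> R -> R) (N M1 M2 : nat).

Definition Bx_mx : 'M[R]_(M2 * M1) :=
  - eta T N (mesh xL xR M1) alpha *: tensmx 1%:M (G_mx alpha M1).

Definition By_mx : 'M[R]_(M2 * M1) :=
  - eta T N (mesh yL yR M2) beta *: tensmx (G_mx beta M2) 1%:M.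

Definition A_mx : 'M[R]_(M2 * M1) :=
  1%:M + diag_mx (samples xL xR yL yR M1 M2 d) *m Bx_mx
       + diag_mx (samples xL xR yL yR M1 M2 e) *m By_mx.

Definition P_mx : 'M[R]_(M2 * M1) :=
  1%:M + mean (samples xL xR yL yR M1 M2 d) *: Bx_mx
       + mean (samples xL xR yL yR M1 M2 e) *: By_mx.

End Matrices.
End Discretization.

Section Coefficients.
Variable R : realType.
Implicit Types (L U sigma m : R) (f Mt Mhat Mcheck : R -> R).

Definition varsigma (gamma : R) : R := `|cos (gamma / 2 * pi)|.

Definition convex_on L U f : Prop :=
  convex_function (`]L, U[%classic : set R) f.

Definition concave_on L U f : Prop := convex_on L U (fun z => - f z).

Definition sup_on L U f : R := sup (f @` `]L, U[).
Definition inf_on L U f : R := inf (f @` `]L, U[).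

(* Admissible values of M~ for the section f; both disjuncts are available
   when f is affine. *)
Definition is_Mtilde L U f m : Prop :=
  (convex_on L U f /\ m = inf_on L U f) \/
  (concave_on L U f /\ m = sup_on L U f).

Definition c_check L U sigma Mt Mhat Mcheck : R :=
  inf_on L U (fun z => Mt z - Num.sqrt 2 / sigma * (Mhat z - Mcheck z)).

Definition c_hat L U sigma Mt Mhat Mcheck : R :=
  sup_on L U (fun z => Mt z + Num.sqrt 2 / sigma * (Mhat z - Mcheck z)).

End Coefficients.

(* Main.v *)
Require Import Defs.
From HB Require Import structures.
From mathcomp Require Import all_boot all_order all_algebra.
From mathcomp Require Import all_classical all_reals all_analysis.
From mathcomp Require Import ring lra.
From mathcomp Require Import zify.

(** Why the theorem is true.  Let S be the diagonal matrix of the samples of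
    [a], m their mean and K = nu1 Bx + nu2 By, so that A = 1 + S K and
    P = 1 + m K.  For z = P u,
      |P u|^2 = |u|^2 + 2 m <u, K u> + m^2 |K u|^2,
      |A u|^2 = |u|^2 + 2 <u, S K u> + |S K u|^2,
    and the squared singular values of A P^-1 are controlled by the ratio of
    the two.  The outer terms compare because S and m lie between the bounds
    of [a] (and <u, K u> >= 0), so everything rests on comparing <u, S K u>
    with <u, K u>: this is [diag_dominated_bounds].

    Both forms split into sums over grid lines.  On one line put
    F(u) = - u^T G u, where G is the Toeplitz matrix of order gamma.  A convex
    section f of [a] is its infimum plus a convex p with values in [0, B],
    where B is the oscillation of f; a concave one is its supremum minus such
    a p.  The line estimate [weighted_form_bound] therefore says that
    |<p u, - G u>| <= (sqrt 2 / varsigma) B F(u), and it follows from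
    - the sector property [toeplitz_sector]: 2 varsigma <v, - G u> is at most
      F(u) + F(v), used with v a multiple of p u; and
    - the multiplier estimate [toeplitz_form_multiplier]:
      F(p u) <= 2 B^2 F(u).

    Sector property.  With s = 2 - gamma and z on the unit circle, the symbol
    of - G is |1 - z|^2 K(z), K(z) = (1 - z)^(-s) (1 - s/2 + (s/2) z).  The
    argument of K stays in [-s pi/2, s pi/2], and varsigma = cos (s pi/2), so
    Re K >= varsigma |K|; applying this at each frequency to the transforms of
    u and v and averaging gives the claim.  To average only finite sums, the
    average is a discrete Fourier one, the symbol is evaluated at radius
    r < 1 and its power series is truncated after n terms.  The closed form of
    the series comes from the differential equation (1 - z) F' = s F along a
    ray, with a geometrically small truncation error, uniform in the angle.
    Then n tends to infinity and r to 1.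

    Multiplier estimate.  The symmetric part of - G has nonpositive
    off-diagonal entries, so F is a Dirichlet form: a sum of
    q_ij (u_i - u_j)^2 / 2 plus a killing term, which is at least the jump
    rate out of the grid.  Multiplying u by p costs the factor p_i p_j <= B^2
    in the jump part and adds the drift p_i sum_j q_ij (p_i - p_j).  By
    convexity of p the jumps from i to i - l and i + l together contribute a
    nonpositive drift when both ends are in the grid, and a jump whose mirror
    image leaves the grid is paid for by the killing term.  Hence the drift is
    at most B^2 times the killing term, whence the factor 2. *)

Set Implicit Arguments.
Unset Strict Implicit.
Unset Printing Implicit Defensive.

Import Order.TTheory GRing.Theory Num.Theory.
Import numFieldNormedType.Exports.

Local Open Scope classical_set_scope.
Local Open Scope ring_scope.

(** * Coefficients of the fractional difference scheme *)

Section Coefs.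
Variable R : realType.
Implicit Types (s p gamma : R) (k : nat -> R).

(** The Taylor coefficients of (1 - z)^(-s) at 0. *)
Fixpoint rising_coef s (n : nat) : R :=
  if n is n'.+1 then (n'%:R + s) / n%:R * rising_coef s n' else 1.

(** Coefficients of (1 - p + p z) c(z), for c the generating function of [c]. *)
Definition times_affine p (c : nat -> R) (n : nat) : R :=
  if n is n'.+1 then (1 - p) * c n + p * c n' else (1 - p) * c 0%N.

(** Coefficients of (1 - z)^2 c(z); the missing terms of negative index
    count as 0. *)
Definition second_diff (c : nat -> R) (n : nat) : R :=
  if n is n1.+1 then
    if n1 is n2.+1 then c n - 2 * c n1 + c n2 else c n - 2 * c n1
  else c 0%N.

Lemma rising_coef_recE s n :
  n.+1%:R * rising_coef s n.+1 = (n%:R + s) * rising_coef s n.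
Proof. by rewrite /= mulrA [_ * (_ / _)]mulrC divfK ?pnatr_eq0. Qed.

Lemma rising_coef_bounds s n : 0 <= s -> s <= 1 -> 0 <= rising_coef s n <= 1.
Proof.
move=> s0 s1; elim: n => [|n /andP[c0 c1]]; first by rewrite /= ler01 lexx.
have n1 : 0 < n.+1%:R :> R by rewrite ltr0n.
have f0 : 0 <= (n%:R + s) / n.+1%:R :> R.
  by rewrite divr_ge0 ?ler0n// addr_ge0 ?ler0n.
have f1 : (n%:R + s) / n.+1%:R <= 1 :> R.
  by rewrite ler_pdivrMr// mul1r -natr1 lerD2l.
rewrite /= mulr_ge0//=; apply: le_trans c1.
by rewrite ler_piMl.
Qed.

Lemma rising_coef_nonincr s n :
  0 <= s -> s <= 1 -> rising_coef s n.+1 <= rising_coef s n.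
Proof.
move=> s0 s1; have /andP[c0 _] := rising_coef_bounds n s0 s1.
rewrite /= ler_piMl// ler_pdivrMr ?ltr0n// mul1r -natr1 lerD2l //.
Qed.

(** Both sides are the coefficients of (1 - z)^(2 - s) = (1 - z)^2 (1 - z)^(-s).
    From index 2 on, both obey the same first-order recurrence, which gives
    the product formula used in the proof. *)
Lemma g_coef_second_diff s n :
  g_coef (2 - s) n = second_diff (rising_coef s) n.
Proof.
have H m : g_coef (2 - s) m.+2 =
   (1 - s) * (2 - s) / (m.+2%:R * m.+1%:R) * rising_coef s m.
  elim: m => [|m IH].
    by rewrite /=; field.
  rewrite -[LHS]/((1 - (2 - s + 1) / m.+3%:R) * g_coef (2 - s) m.+2) IH.
  rewrite -[rising_coef s m.+1]/((m%:R + s) / m.+1%:R * rising_coef s m).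
  have e1 : m.+1%:R = m%:R + 1 :> R by rewrite -natr1.
  have e2 : m.+2%:R = m%:R + 2 :> R by rewrite -addn2 natrD.
  have e3 : m.+3%:R = m%:R + 3 :> R by rewrite -addn3 natrD.
  have m0 : 0 <= m%:R :> R by [].
  rewrite e1 e2 e3; field; rewrite !lt0r_neq0//; lra.
case: n => [//|[|m]]; first by rewrite /=; field.
rewrite H /=.
have e1 : m.+1%:R = m%:R + 1 :> R by rewrite -natr1.
have e2 : m.+2%:R = m%:R + 2 :> R by rewrite -addn2 natrD.
have m0 : 0 <= m%:R :> R by [].
by rewrite e1 e2; field; rewrite !lt0r_neq0//; lra.
Qed.

(** In generating functions, w(z) = (1 - z)^2 K(z) where
    K(z) = (1 - z)^(-s) (1 - s/2 + (s/2) z): the factorization of the symbol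
    through which the sector property is proved. *)
Lemma w_coef_second_diff s n :
  w_coef (2 - s) n = second_diff (times_affine (s / 2) (rising_coef s)) n.
Proof.
have h x : (2 - (2 - s)) / 2 * x = s / 2 * x by congr (_ * _); field.
have h' x : (2 - s) / 2 * x = (1 - s / 2) * x by congr (_ * _); field.
case: n => [|[|[|n]]]; rewrite /w_coef !g_coef_second_diff ?h ?h'; cbn -[rising_coef];
  ring.
Qed.

Lemma g_coef_ge0 gamma n : 1 <= gamma <= 2 -> 0 <= g_coef gamma n.+2.
Proof.
move=> /andP[g1 g2]; elim: n => [|n IH]; first by rewrite /=; nra.
rewrite -[g_coef gamma n.+3]/((1 - (gamma + 1) / n.+3%:R) * g_coef gamma n.+2).
apply: mulr_ge0 => //; rewrite subr_ge0 ler_pdivrMr ?ltr0n// mul1r.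
have : 3 <= n.+3%:R :> R by rewrite ler_nat.
lra.
Qed.

Lemma w_coef_ge0 gamma n : 1 <= gamma <= 2 -> 0 <= w_coef gamma n.+3.
Proof.
move=> g12; rewrite /w_coef addr_ge0// mulr_ge0 ?g_coef_ge0//; lra.
Qed.

(** The entries of G next to the diagonal are w_0 and w_2.  The second may be
    negative, but the symmetric part of G only sees their sum, which is
    gamma (gamma + 2) (gamma - 1) / 4. *)
Lemma w_coef02_ge0 gamma :
  1 <= gamma <= 2 -> 0 <= w_coef gamma 0 + w_coef gamma 2.
Proof.
move=> g12; rewrite /w_coef /g_coef.
have -> : gamma / 2 * 1 + (gamma / 2 * ((1 - (gamma + 1) / 2) *
   ((1 - (gamma + 1) / 1) * 1)) + (2 - gamma) / 2 * ((1 - (gamma + 1) / 1) * 1))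
  = gamma / 4 * ((gamma + 2) * (gamma - 1)) by field.
by rewrite mulr_ge0// ?mulr_ge0//; lra.
Qed.

(** The sum telescopes. *)
Lemma sum_second_diff (c : nat -> R) n :
  \sum_(k < n.+2) second_diff c k = c n.+1 - c n.
Proof.
elim: n => [|n IH]; first by rewrite !big_ord_recr big_ord0 /=; ring.
by rewrite big_ord_recr /= IH /=; ring.
Qed.

(** By telescoping, the partial sums of w are first differences of the
    coefficients of K, and these coefficients decrease.  This provides the
    diagonal dominance of - G. *)
Lemma sum_w_coef_le0 gamma n :
  1 <= gamma <= 2 -> \sum_(k < n.+3) w_coef gamma k <= 0.
Proof.
move=> g12; pose s := 2 - gamma.
rewrite (eq_bigr (fun k : 'I__ =>
  second_diff (times_affine (s / 2) (rising_coef s)) k)); last first.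
  by move=> k _; rewrite -w_coef_second_diff; congr w_coef; rewrite /s; ring.
have s0 : 0 <= s by rewrite /s; lra.
have s1 : s <= 1 by rewrite /s; lra.
rewrite sum_second_diff.
have h1 := rising_coef_nonincr n s0 s1.
have h2 := rising_coef_nonincr n.+1 s0 s1.
cbn -[rising_coef]; nra.
Qed.

End Coefs.

(** * Toeplitz forms as discrete Fourier averages *)

Section Fourier.
Variable R : realType.
Implicit Types (x y z theta : R).

(** Each term of the product is a difference of two consecutive sines, so the
    sum telescopes. *)
Lemma sin_mul_sum_cos x n :
  2 * sin (x / 2) * \sum_(m < n) cos (m%:R * x) =
  sin (n%:R * x - x / 2) + sin (x / 2).
Proof.
elim: n => [|n IH]; first by rewrite big_ord0 mulr0 mul0r sub0r sinN addNr.
rewrite big_ord_recr mulrDr IH /=.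
have -> : n.+1%:R * x - x / 2 = n%:R * x + x / 2.
  by rewrite -natr1; field.
rewrite sinB sinD; ring.
Qed.

Definition dft_node (N m : nat) : R := 2 * pi * m%:R / N%:R.

(** Orthogonality of the N-th roots of unity: the telescoped sum runs over a
    full period. *)
Lemma sum_cos_dft_node (N l : nat) : (0 < l < N)%N ->
  \sum_(m < N) cos (l%:R * dft_node N m) = 0.
Proof.
move=> /andP[l0 lN].
have N0 : N%:R != 0 :> R by rewrite pnatr_eq0 -lt0n (leq_trans _ lN).
have Np : 0 < N%:R :> R by rewrite ltr0n (leq_trans _ lN).
pose x : R := 2 * pi * l%:R / N%:R.
have ex : \sum_(m < N) cos (l%:R * dft_node N m) = \sum_(m < N) cos (m%:R * x).
  by apply: eq_bigr => m _; congr cos; rewrite /dft_node /x; field.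
have pi0 := pi_gt0 R.
have sx : 0 < sin (x / 2).
  apply: sin_gt0_pi; apply/andP; split.
    by rewrite divr_gt0 // divr_gt0// !mulr_gt0 ?ltr0n.
  rewrite /x ltr_pdivrMr// ltr_pdivrMr// -(mulrA 2) (mulrC 2) -!mulrA.
  by rewrite ltr_pM2l// mulrC ltr_pM2l// ltr_nat.
have := sin_mul_sum_cos x N; rewrite -ex.
have -> : N%:R * x - x / 2 = - (x / 2) + l%:R * (pi *+ 2).
  by rewrite /x mulr2n; field.
rewrite [l%:R * _]mulr_natl.
have -> : sin (- (x / 2) + pi *+ 2 *+ l) = - sin (x / 2).
  by rewrite (periodicn (@sinD2pi R)) sinN.
rewrite addNr => /eqP; rewrite mulf_eq0 => /orP[|/eqP//].
by rewrite mulf_eq0 pnatr_eq0 /= gt_eqF.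
Qed.

Lemma sum_cos_sub_dft_node (N x y : nat) : (x < y + N)%N -> (y < x + N)%N ->
  \sum_(m < N) cos (x%:R * dft_node N m - y%:R * dft_node N m) =
  N%:R * (x == y)%:R.
Proof.
have lt_case a b : (b < a)%N -> (a < b + N)%N ->
  \sum_(m < N) cos (a%:R * dft_node N m - b%:R * dft_node N m) = 0.
  move=> ba abN; rewrite -[RHS](@sum_cos_dft_node N (a - b)); last first.
    by rewrite subn_gt0 ba ltn_subLR// ltnW.
  by apply: eq_bigr => m _; rewrite -mulrBl natrB// ltnW.
case: (ltngtP x y) => [xy _ yx|xy xN _|<- _ _].
- rewrite mulr0 -[RHS](lt_case _ _ xy yx).
  by apply: eq_bigr => m _; rewrite -cosN opprB.
- by rewrite mulr0; exact: lt_case.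
- under eq_bigr do rewrite subrr cos0.
  by rewrite sumr_const card_ord mulr1.
Qed.

Definition cos_sum n (f : 'I_n -> R) theta := \sum_(j < n) f j * cos (j%:R * theta).
Definition sin_sum n (f : 'I_n -> R) theta := \sum_(j < n) f j * sin (j%:R * theta).

(** The bilinear form v^T G u of the Toeplitz matrix with coefficients [w].
    It is kept as a sum over functions, since it is applied to the many grid
    lines of one vector. *)
Definition toeplitz_form M (w : nat -> R) (v u : 'I_M -> R) : R :=
  \sum_(a < M) \sum_(b < M) v a * (if (b <= a.+1)%N then w (a.+1 - b)%N else 0) * u b.

(** The real part of K(z) U(z) conj(V(z)) at z = exp (i theta), where K, U, V
    are the polynomials with coefficients [k], [u], [v]. *)
Definition spectral_form n M (k : 'I_n -> R) (v u : 'I_M -> R) theta : R :=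
  cos_sum k theta * (cos_sum u theta * cos_sum v theta +
                     sin_sum u theta * sin_sum v theta)
  - sin_sum k theta * (sin_sum u theta * cos_sum v theta -
                     cos_sum u theta * sin_sum v theta).

Lemma spectral_formE n M (k : 'I_n -> R) (v u : 'I_M -> R) theta :
  spectral_form k v u theta =
  \sum_(j < n) \sum_(a < M) \sum_(b < M) k j * u b * v a *
     cos ((j + b)%:R * theta - a%:R * theta).
Proof.
rewrite /spectral_form /cos_sum /sin_sum !big_distrlr /= -big_split /= -sumrB.
rewrite !big_distrlr -sumrB; apply: eq_bigr => j _ /=.
rewrite -sumrB [RHS]exchange_big; apply: eq_bigr => b _ /=.
rewrite -big_split -sumrB/= !mulr_sumr -sumrB; apply: eq_bigr => a _ /=.
rewrite natrD mulrDl cosB !sinD !cosD; ring.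
Qed.

(** Multiplication by |1 - z|^2 acts on the Fourier modes as a negative second
    difference. *)
Lemma shifted_cos (x y : nat) theta :
  (2 - 2 * cos theta) * cos (x%:R * theta - y%:R * theta) =
  2 * cos (x%:R * theta - y%:R * theta)
  - cos (x.+1%:R * theta - y%:R * theta) - cos (x%:R * theta - y.+1%:R * theta).
Proof.
rewrite -!natr1 !mulrDl !mul1r.
have -> : x%:R * theta + theta - y%:R * theta = (x%:R * theta - y%:R * theta) + theta by ring.
have -> : x%:R * theta - (y%:R * theta + theta) = (x%:R * theta - y%:R * theta) - theta by ring.
rewrite [cos (_ + theta)]cosD [cos (_ - _ - theta)]cosB; ring.
Qed.

(** The three Kronecker symbols select the indices a - b, a - b - 1 and
    a - b + 1, which assemble a second difference of [k]; the bound on [n]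
    keeps all of them in the range of summation. *)
Lemma sum_second_diff_delta n (k : nat -> R) (a b : nat) : (a.+1 < n)%N ->
  \sum_(j < n) k j * (2 * (j + b == a)%N%:R - ((j + b).+1 == a)%N%:R
     - (j + b == a.+1)%N%:R) =
  - (if (b <= a.+1)%N then second_diff k (a.+1 - b)%N else 0).
Proof.
move=> an.
have delta c : (c < n + b)%N -> \sum_(j < n) k j * (j + b == c)%N%:R =
    if (b <= c)%N then k (c - b)%N else 0.
  move=> cn; case: leqP => [bc|cb].
    have lt : (c - b < n)%N by rewrite ltn_subLR// addnC.
    rewrite (bigD1 (Ordinal lt)) //= subnK// eqxx mulr1 big1 ?addr0// => j.
    rewrite -val_eqE /= => jc; case: eqP => [e|]; last by rewrite mulr0.
    by move: jc; rewrite -e addnK eqxx.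
  rewrite big1// => j _; case: eqP => [e|]; last by rewrite mulr0.
  by move: cb; rewrite -e ltnNge leq_addl.
have e : \sum_(j < n) k j * (2 * (j + b == a)%N%:R - ((j + b).+1 == a)%N%:R
     - (j + b == a.+1)%N%:R) =
   2 * (\sum_(j < n) k j * (j + b == a)%N%:R)
   - (\sum_(j < n) k j * ((j + b).+1 == a)%N%:R)
   - (\sum_(j < n) k j * (j + b == a.+1)%N%:R).
  by rewrite mulr_sumr -!sumrB; apply: eq_bigr => j _; ring.
rewrite e !delta; last 2 first.
- by rewrite ltn_addr.
- by rewrite ltn_addr// ltnW.
have -> : \sum_(j < n) k j * ((j + b).+1 == a)%N%:R =
   if (b < a)%N then k (a.-1 - b)%N else 0.
  case: a an {e} => [|a] an.
    by rewrite big1// => j _; rewrite mulr0.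
  by rewrite ltnS -delta// ltn_addr// -ltnS ltnW// ltnW.
case: (ltngtP b a.+1) => [|ba|->]; last first.
- rewrite ltnn ltnNge leqnSn /= subnn /=; ring.
- rewrite (leqNgt b a) (ltnW ba) /= [(b < a)%N]ltnNge [(a <= b)%N]ltnW ?(ltnW ba)//=; ring.
rewrite ltnS; case: (ltngtP b a) => // [ba _|-> _]; last first.
  by rewrite subnn subSnn /=; ring.
have -> : (a.+1 - b = (a - b).-1.+2)%N by lia.
have -> : (a - b = (a - b).-1.+1)%N by lia.
have -> : (a.-1 - b = (a - b).-1)%N by lia.
by rewrite /=; ring.
Qed.

(** Averaging over the N-th roots of unity extracts the constant Fourier mode.
    Since N exceeds all the frequencies present, no aliasing occurs and the
    identity is exact. *)
Lemma sum_spectral_form (N n M : nat) (k : nat -> R) (v u : 'I_M -> R) :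
  (M < n)%N -> (n + M < N)%N ->
  \sum_(m < N) (2 - 2 * cos (dft_node N m)) *
     spectral_form (fun j : 'I_n => k j) v u (dft_node N m) =
  - N%:R * toeplitz_form (second_diff k) v u.
Proof.
move=> Mn nMN.
have -> : - N%:R * toeplitz_form (second_diff k) v u =
  N%:R * \sum_(a < M) \sum_(b < M) u b * v a *
  (\sum_(j < n) k j * (2 * (j + b == a)%N%:R - ((j + b).+1 == a)%N%:R
     - (j + b == a.+1)%N%:R)).
  rewrite mulNr -mulrN; congr (_ * _); rewrite /toeplitz_form -sumrN.
  apply: eq_bigr => a _; rewrite -sumrN; apply: eq_bigr => b _.
  rewrite sum_second_diff_delta ?(leq_ltn_trans (ltn_ord a))//; ring.
under eq_bigr do rewrite spectral_formE mulr_sumr.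
rewrite exchange_big mulr_sumr /=.
under [RHS]eq_bigr => a _.
  rewrite mulr_sumr.
  under eq_bigr => b _ do rewrite mulr_sumr mulr_sumr.
  rewrite exchange_big /=.
  over.
rewrite [RHS]exchange_big /=; apply: eq_bigr => j _.
under eq_bigr do rewrite mulr_sumr.
rewrite exchange_big /=; apply: eq_bigr => a _.
under eq_bigr do rewrite mulr_sumr.
rewrite exchange_big /=; apply: eq_bigr => b _.
have := ltn_ord a; have := ltn_ord b; have := ltn_ord j => jn bM aM.
under eq_bigr do rewrite mulrCA shifted_cos.
rewrite -mulr_sumr !sumrB -mulr_sumr !sum_cos_sub_dft_node; try lia.
ring.
Qed.

End Fourier.

(** * Differentiation of polynomials and the mean value inequality *)

Section Derivation.
Variable R : realType.
Implicit Types (f g df dg : R -> R) (a b x t : R).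

(** Both g - f and g + f have nonnegative derivatives. *)
Lemma mean_value_le f g df dg a b : a <= b ->
  (forall x, a <= x <= b -> is_derive x 1 f (df x)) ->
  (forall x, a <= x <= b -> is_derive x 1 g (dg x)) ->
  (forall x, a <= x <= b -> `|df x| <= dg x) ->
  `|f b - f a| <= g b - g a.
Proof.
move=> ab fd gd h.
have mono (h1 dh : R -> R) :
    (forall x, a <= x <= b -> is_derive x 1 h1 (dh x)) ->
    (forall x, a <= x <= b -> 0 <= dh x) -> h1 a <= h1 b.
  move=> hd h0; have [||c] := @MVT_segment R h1 dh a b ab.
  - by move=> x; rewrite in_itv /= => /andP[/ltW ax /ltW xb]; apply: hd; rewrite ax.
  - apply: derivable_within_continuous => x; rewrite in_itv /= => xab.
    by have [] := hd _ xab.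
  - rewrite in_itv /= => cab e; rewrite -subr_ge0 e mulr_ge0 ?subr_ge0// h0//.
rewrite ler_norml; apply/andP; split.
- have := mono (f + g) (fun x => df x + dg x).
  rewrite /= !fctE => H; have : f a + g a <= f b + g b; last lra.
  apply: H => x xab; first by apply: is_deriveD; [exact: fd|exact: gd].
  by have := h _ xab; rewrite ler_norml => /andP[]; lra.
- have := mono (g - f) (fun x => dg x - df x).
  rewrite /= !fctE => H; have : g a - f a <= g b - f b; last lra.
  apply: H => x xab; first by apply: is_deriveB; [exact: gd|exact: fd].
  by have := h _ xab; rewrite ler_norml => /andP[]; lra.
Qed.

Definition pow_sum n (f : nat -> R) t := \sum_(j < n) f j * t ^+ j.
Definition deriv_pow_sum n (f : nat -> R) t := \sum_(j < n) f j * (j%:R * t ^+ j.-1).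

Lemma is_derive_addf f g t (a b : R) : is_derive t 1 f a -> is_derive t 1 g b ->
  is_derive t 1 (fun x => f x + g x) (a + b).
Proof. exact: is_deriveD. Qed.

Lemma is_derive_mulf f g t (a b : R) : is_derive t 1 f a -> is_derive t 1 g b ->
  is_derive t 1 (fun x => f x * g x) (a * g t + f t * b).
Proof.
move=> fa gb; have := is_deriveM fa gb.
by rewrite /GRing.scale /= addrC [g t * a]mulrC.
Qed.

Lemma is_derive_affine (a b : R) t : is_derive t 1 (fun x => a + x * b) b.
Proof.
have := is_derive_addf (is_derive_cst (a : R^o) t 1)
  (is_derive_mulf (is_derive_id t 1) (is_derive_cst (b : R^o) t 1)).
by rewrite mulr0 addr0 add0r mul1r.
Qed.

Lemma is_derive_pow (n : nat) t :
  is_derive t 1 (fun x : R => x ^+ n) (n%:R * t ^+ n.-1).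
Proof.
have := is_deriveX n (is_derive_id t (1 : R^o)).
by rewrite /GRing.scale /= mulr1 exprfctE.
Qed.

Lemma is_derive_pow_sum n (f : nat -> R) t :
  is_derive t 1 (pow_sum n f) (deriv_pow_sum n f t).
Proof.
elim: n => [|n IH].
  rewrite /deriv_pow_sum big_ord0; have -> : pow_sum 0 f = cst 0.
    by apply/funext => x; rewrite /pow_sum big_ord0.
  exact: is_derive_cst.
rewrite /deriv_pow_sum big_ord_recr.
have -> : pow_sum n.+1 f = pow_sum n f + (f n *: (fun x : R => x ^+ n)).
  by apply/funext => x; rewrite /pow_sum big_ord_recr.
apply: is_deriveD; apply: is_deriveZ; exact: is_derive_pow.
Qed.

End Derivation.

(** * The binomial series along a ray of the unit disc *)

Section ClosedForm.
Variables (R : realType) (s theta : R).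
Implicit Types (r t x : R) (n : nat).

Let c := cos theta.
Let d := sin theta.

(** Real and imaginary parts, at z = t exp (i theta), of the sum of the first
    [n] terms of the series of (1 - z)^(-s); below, their derivatives in [t]. *)
Definition binom_re n t := pow_sum n (fun j => rising_coef s j * cos (j%:R * theta)) t.
Definition binom_im n t := pow_sum n (fun j => rising_coef s j * sin (j%:R * theta)) t.
Definition dbinom_re n t :=
  deriv_pow_sum n (fun j => rising_coef s j * cos (j%:R * theta)) t.
Definition dbinom_im n t :=
  deriv_pow_sum n (fun j => rising_coef s j * sin (j%:R * theta)) t.

(** The truncation F_n of (1 - z)^(-s) satisfies (1 - z) F_n' = s F_n up to the
    single monomial n c_n z^(n-1), because n c_n = (n - 1 + s) c_(n-1).  The two
    equations are the real and imaginary parts along a ray. *)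
Lemma binom_ode n t :
  (1 - t * c) * dbinom_re n t + t * d * dbinom_im n t =
    s * (c * binom_re n t - d * binom_im n t)
    - n%:R * rising_coef s n * t ^+ n.-1 * cos (n%:R * theta) /\
  (1 - t * c) * dbinom_im n t - t * d * dbinom_re n t =
    s * (c * binom_im n t + d * binom_re n t)
    - n%:R * rising_coef s n * t ^+ n.-1 * sin (n%:R * theta).
Proof.
elim: n => [|n [IH1 IH2]].
  rewrite /dbinom_re /dbinom_im /binom_re /binom_im /pow_sum /deriv_pow_sum.
  by rewrite !big_ord0; split; ring.
have e : n%:R * t ^+ n = n%:R * t ^+ n.-1 * t.
  by case: n {IH1 IH2} => [|n] /=; rewrite ?mul0r// exprSr mulrA.
have cS : cos (n.+1%:R * theta) = cos (n%:R * theta) * c - sin (n%:R * theta) * d.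
  by rewrite -natr1 mulrDl mul1r cosD.
have sS : sin (n.+1%:R * theta) = sin (n%:R * theta) * c + cos (n%:R * theta) * d.
  by rewrite -natr1 mulrDl mul1r sinD.
have re := rising_coef_recE s n.
have E1 : dbinom_re n.+1 t = dbinom_re n t +
    rising_coef s n * cos (n%:R * theta) * (n%:R * t ^+ n.-1).
  by rewrite /dbinom_re /deriv_pow_sum big_ord_recr.
have E2 : dbinom_im n.+1 t = dbinom_im n t +
    rising_coef s n * sin (n%:R * theta) * (n%:R * t ^+ n.-1).
  by rewrite /dbinom_im /deriv_pow_sum big_ord_recr.
have E3 : binom_re n.+1 t = binom_re n t + rising_coef s n * cos (n%:R * theta) * t ^+ n.
  by rewrite /binom_re /pow_sum big_ord_recr.
have E4 : binom_im n.+1 t = binom_im n t + rising_coef s n * sin (n%:R * theta) * t ^+ n.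
  by rewrite /binom_im /pow_sum big_ord_recr.
rewrite E1 E2 E3 E4 cS sS re [n.+1.-1]/=.
move: (cos _) (sin _) (rising_coef s n) IH1 IH2 => C S a IH1 IH2.
have e' x : x * n%:R * t ^+ n.-1 * t = x * n%:R * t ^+ n.
  by rewrite -!mulrA; congr (_ * _); rewrite e mulrA.
split.
- transitivity (((1 - t * c) * dbinom_re n t + t * d * dbinom_im n t)
     + a * C * (n%:R * t ^+ n.-1) - a * (C * c - S * d) * (n%:R * t ^+ n.-1 * t)).
    ring.
  rewrite -e IH1; ring.
- transitivity (((1 - t * c) * dbinom_im n t - t * d * dbinom_re n t)
     + a * S * (n%:R * t ^+ n.-1) - a * (S * c + C * d) * (n%:R * t ^+ n.-1 * t)).
    ring.
  rewrite -e IH2; ring.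
Qed.

(** The squared distance |1 - z|^2, at z = t exp (i theta). *)
Definition sqdist t := 1 - 2 * t * c + t ^+ 2.
(** The argument of 1 / (1 - z). *)
Definition phase t := atan (t * d / (1 - t * c)).
(** The real part of (X + i Y) (1 - z)^s, with the power written in polar form;
    its imaginary part is [unwind_re Y (- X)].  Applied to the full binomial
    series it would be the constant 1. *)
Definition unwind_re (X Y : R -> R) t :=
  sqdist t `^ (s / 2) * (cos (s * phase t) * X t + sin (s * phase t) * Y t).

Let c2d2 : c ^+ 2 + d ^+ 2 = 1. Proof. exact: cos2Dsin2. Qed.
Let c_le1 : c <= 1. Proof. exact: cos_le1. Qed.
Let c_geN1 : -1 <= c. Proof. exact: cos_geN1. Qed.

Lemma one_sub_cos_gt0 t : 0 <= t < 1 -> 0 < 1 - t * c.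
Proof.
move=> /andP[t0 t1]; have : t * c <= t by rewrite ler_piMr.
by lra.
Qed.

Lemma sqdistE t : sqdist t = (1 - t * c) ^+ 2 + (t * d) ^+ 2.
Proof. by rewrite /sqdist exprMn -[d ^+ 2](addrK (c ^+ 2)) [d ^+ 2 + _]addrC c2d2; ring. Qed.

Lemma sqdist_gt0 t : 0 <= t < 1 -> 0 < sqdist t.
Proof.
move=> t01; rewrite sqdistE ltr_pwDl ?sqr_ge0//.
by rewrite exprn_gt0// one_sub_cos_gt0.
Qed.

Lemma is_derive_phase t : 0 <= t < 1 -> is_derive t 1 phase (d / sqdist t).
Proof.
move=> t01; have q0 := one_sub_cos_gt0 t01; have r0 := sqdist_gt0 t01.
have h1 : is_derive t 1 (fun x : R => x * d) d.
  by have := is_derive_affine 0 d t; under eq_fun do rewrite add0r.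
have h2 : is_derive t 1 (fun x : R => 1 - x * c) (- c).
  by have := is_derive_affine 1 (- c) t; under eq_fun do rewrite mulrN.
have h3 := is_derive_mulf h1 (@is_deriveV R (fun x => 1 - x * c) t (- c) 1 (lt0r_neq0 q0) h2).
have h4 := is_derive1_comp (is_derive1_atan _) h3.
apply: (is_derive_eq h4); rewrite /GRing.scale /=.
have r0' := lt0r_neq0 r0; rewrite sqdistE in r0' *.
have q0' := lt0r_neq0 q0.
by field; rewrite r0'.
Qed.

(** The logarithmic derivative of (1 - z)^s along the ray is
    - s exp (i theta) / (1 - z), with real part s (t - c) / |1 - z|^2 and
    imaginary part - s d / |1 - z|^2. *)
Lemma is_derive_unwind_re (X Y : R -> R) X' Y' t : 0 <= t < 1 ->
  is_derive t 1 X X' -> is_derive t 1 Y Y' ->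
  is_derive t 1 (unwind_re X Y) (sqdist t `^ (s / 2) / sqdist t *
    (s * (t - c) * (cos (s * phase t) * X t + sin (s * phase t) * Y t)
     + s * d * (cos (s * phase t) * Y t - sin (s * phase t) * X t)
     + sqdist t * (cos (s * phase t) * X' + sin (s * phase t) * Y'))).
Proof.
move=> t01 dX dY; have r0 := sqdist_gt0 t01; have r0' := lt0r_neq0 r0.
have hr : is_derive t 1 sqdist (2 * (t - c)).
  have := is_derive_addf (is_derive_affine 1 (- (2 * c)) t) (is_derive_pow 2 t).
  have -> : (fun x => 1 + x * - (2 * c) + x ^+ 2) = sqdist.
    by apply/funext => x; rewrite /sqdist; ring.
  by move=> h; apply: (is_derive_eq h) => /=; ring.
have hE : is_derive t 1 (fun x => sqdist x `^ (s / 2))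
            (s * (t - c) * (sqdist t `^ (s / 2) / sqdist t)).
  have h := is_derive1_comp (is_derive1_powR (s / 2) r0) hr.
  apply: (is_derive_eq h).
  rewrite powRB ?powRr1 ?(ltW r0)//; last by rewrite r0' implybT.
  by field.
have hw : is_derive t 1 (fun x => s * phase x) (s * (d / sqdist t)).
  have := is_derive_mulf (is_derive_cst (s : R^o) t 1) (is_derive_phase t01).
  by rewrite mul0r add0r.
have hC := @is_derive1_comp R cos (fun x => s * phase x) t _ _ (is_derive_cos _) hw.
have hS := @is_derive1_comp R sin (fun x => s * phase x) t _ _ (is_derive_sin _) hw.
have := is_derive_mulf hE
  (is_derive_addf (is_derive_mulf hC dX) (is_derive_mulf hS dY)).
move=> h; apply: (is_derive_eq h) => /=; by field.
Qed.

Lemma sqdist_ge r t : 0 <= t <= r -> r < 1 -> (1 - r) ^+ 2 <= sqdist t <= 4.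
Proof.
move=> /andP[t0 tr] r1; apply/andP; split.
  have h : (1 - t) ^+ 2 <= sqdist t.
    rewrite -subr_ge0 (_ : _ - _ = 2 * (t - t * c)); last by rewrite /sqdist; ring.
    by rewrite mulr_ge0// subr_ge0 ler_piMr.
  by apply: le_trans h; rewrite ler_pXn2r ?nnegrE//; lra.
rewrite -subr_ge0 (_ : _ - _ = 2 * (t * (1 + c)) + (1 - t) * (3 + t)).
  have c1 : 0 <= 1 + c by rewrite -lerBlDl sub0r.
  have t1 : 0 <= 1 - t by lra.
  have t3 : 0 <= 3 + t by lra.
  by rewrite addr_ge0// !mulr_ge0.
by rewrite /sqdist; ring.
Qed.

Hypothesis s01 : 0 <= s <= 1.

Lemma sqdist_powR_bounds r t : 0 <= t <= r -> r < 1 ->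
  (1 - r) ^+ 2 <= sqdist t `^ (s / 2) <= 4.
Proof.
move=> tr r1; have /andP[lo hi] := sqdist_ge tr r1.
have [t0 tr'] := andP tr; have [s0 s1] := andP s01.
have q0 : 0 < (1 - r) ^+ 2 by rewrite exprn_gt0// subr_gt0.
apply/andP; split.
  apply: (@le_trans _ _ (((1 - r) ^+ 2) `^ (s / 2))).
    apply: ger1_powR; last lra.
    rewrite q0 /= expr_le1//; lra.
  apply: ge0_ler_powR; rewrite ?nnegrE; lra.
apply: (@le_trans _ _ (4 `^ (s / 2))).
  apply: ge0_ler_powR; rewrite ?nnegrE; lra.
by apply: ler1_powR; lra.
Qed.

(** A bound 6 * 4 / (1 - r)^2: 6 for the combination of the two remainders
    below, 4 for |1 - z|^s and (1 - r)^2 for |1 - z|^2. *)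
Definition unwind_rate r : R := 24 / (1 - r) ^+ 2.

Lemma trig_combination_le (A B G1 G2 : R) x : `|G1| <= A -> `|G2| <= B ->
  `|cos x * G1 + sin x * G2| <= A + B.
Proof.
move=> h1 h2; apply: le_trans (ler_normD _ _) _; rewrite !normrM lerD//.
  by apply: le_trans h1; rewrite ler_piMl// cos_max.
by apply: le_trans h2; rewrite ler_piMl// sin_max.
Qed.

Lemma unwind_deriv_bound r t n (e1 e2 : R) : 0 <= t <= r -> r < 1 ->
  `|e1| <= n%:R * t ^+ n.-1 -> `|e2| <= n%:R * t ^+ n.-1 ->
  forall x, `|sqdist t `^ (s / 2) / sqdist t *
    (cos x * ((1 - t * c) * e1 - t * d * e2)
     + sin x * (t * d * e1 + (1 - t * c) * e2))| <=
  unwind_rate r * (n%:R * t ^+ n.-1).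
Proof.
move=> tr r1 h1 h2 x; have /andP[lo hi] := sqdist_powR_bounds tr r1.
have /andP[lo' _] := sqdist_ge tr r1; have [t0 tr'] := andP tr.
have q0 : 0 < (1 - r) ^+ 2 by rewrite exprn_gt0// subr_gt0.
set q := n%:R * _; have q_ge0 : 0 <= q by rewrite mulr_ge0// exprn_ge0.
have b1 : `|1 - t * c| <= 2.
  rewrite ler_norml; have : t * c <= t by rewrite ler_piMr.
  have : - t <= t * c by rewrite -[- t]mulrN1 ler_wpM2l.
  by move=> u v; apply/andP; split; lra.
have b2 : `|t * d| <= 1.
  rewrite normrM -[leRHS]mulr1 ler_pM// ?sin_max// ger0_norm//; lra.
have b3 : `|(1 - t * c) * e1 - t * d * e2| <= 3 * q.
  apply: le_trans (ler_normB _ _) _; rewrite [_ * d]lock !normrM -lock.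
  have := ler_pM (normr_ge0 _) (normr_ge0 _) b1 h1.
  have := ler_pM (normr_ge0 _) (normr_ge0 _) b2 h2; rewrite -/q; lra.
have b4 : `|t * d * e1 + (1 - t * c) * e2| <= 3 * q.
  apply: le_trans (ler_normD _ _) _; rewrite [_ * d]lock !normrM -lock.
  have := ler_pM (normr_ge0 _) (normr_ge0 _) b1 h2.
  have := ler_pM (normr_ge0 _) (normr_ge0 _) b2 h1; rewrite -/q; lra.
rewrite normrM.
have -> : unwind_rate r * q = 4 / (1 - r) ^+ 2 * (3 * q + 3 * q).
  by rewrite /unwind_rate; ring.
apply: ler_pM => //; last exact: trig_combination_le.
rewrite ger0_norm; last first.
  by rewrite divr_ge0 ?powR_ge0// (le_trans (ltW q0)).
apply: ler_pM; rewrite ?powR_ge0// ?invr_ge0 ?(le_trans (ltW q0))//.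
by rewrite lef_pV2 ?posrE// (lt_le_trans q0).
Qed.

Lemma unwind_re0 X Y : unwind_re X Y 0 = X 0.
Proof.
rewrite /unwind_re /sqdist /phase !mul0r atan0 !mulr0 cos0 sin0 !mul0r.
by rewrite expr0n /= subr0 !addr0 powR1 !mul1r.
Qed.

(** When F = X + i Y satisfies (1 - z) F' = s exp (i theta) F - (e1 + i e2), with
    F' the derivative along the ray, only the remainder is left in the derivative
    of F (1 - z)^s. *)
Lemma unwind_ode_identity x (C S X Y X' Y' : R)
  (e1 := s * (c * X - d * Y) - ((1 - x * c) * X' + x * d * Y'))
  (e2 := s * (c * Y + d * X) - ((1 - x * c) * Y' - x * d * X')) :
  - (C * ((1 - x * c) * e1 - x * d * e2) + S * (x * d * e1 + (1 - x * c) * e2)) =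
  s * (x - c) * (C * X + S * Y) + s * d * (C * Y - S * X)
    + sqdist x * (C * X' + S * Y').
Proof.
apply/eqP; rewrite -subr_eq0 sqdistE.
rewrite (_ : _ - _ = s * x * (c ^+ 2 + d ^+ 2 - 1) * (C * X + S * Y)).
  by rewrite c2d2 subrr mulr0 mul0r.
by rewrite /e1 /e2; ring.
Qed.

(** The derivative is at most a constant times n t^(n-1), the derivative of
    t^n; integrating it produces the geometric factor r^n. *)
Lemma unwind_re_bound r n (X Y X' Y' e1 e2 : R -> R) : 0 <= r < 1 ->
  (forall x, 0 <= x <= r -> is_derive x 1 X (X' x)) ->
  (forall x, 0 <= x <= r -> is_derive x 1 Y (Y' x)) ->
  (forall x, (1 - x * c) * X' x + x * d * Y' x = s * (c * X x - d * Y x) - e1 x) ->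
  (forall x, (1 - x * c) * Y' x - x * d * X' x = s * (c * Y x + d * X x) - e2 x) ->
  (forall x, 0 <= x <= r -> `|e1 x| <= n%:R * x ^+ n.-1) ->
  (forall x, 0 <= x <= r -> `|e2 x| <= n%:R * x ^+ n.-1) ->
  (0 < n)%N ->
  `|unwind_re X Y r - X 0| <= unwind_rate r * r ^+ n.
Proof.
move=> /andP[r0 r1] hX hY ode1 ode2 b1 b2 n0.
have lt1 (x : R) : 0 <= x <= r -> 0 <= x < 1.
  by move=> /andP[-> /le_lt_trans ->].
have hg (x : R) : is_derive x 1 (fun x => unwind_rate r * x ^+ n)
      (unwind_rate r * (n%:R * x ^+ n.-1)).
  have := is_derive_mulf (is_derive_cst (unwind_rate r : R^o) x 1) (is_derive_pow n x).
  by rewrite mul0r add0r.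
have -> : unwind_rate r * r ^+ n = unwind_rate r * r ^+ n - unwind_rate r * 0 ^+ n.
  by rewrite expr0n -[n == 0]/(n == 0)%N eqn0Ngt n0 mulr0 subr0.
rewrite -(unwind_re0 X Y).
apply: (@mean_value_le R _ (fun x => unwind_rate r * x ^+ n) _
  (fun x => unwind_rate r * (n%:R * x ^+ n.-1)) 0 r r0).
  by move=> x xr; apply: is_derive_unwind_re (lt1 _ xr) (hX _ xr) (hY _ xr).
move=> x xr /=.
have := unwind_deriv_bound xr r1 (b1 _ xr) (b2 _ xr) (s * phase x).
rewrite -normrN; congr (is_true (`|_| <= _)).
rewrite -mulrN -unwind_ode_identity; congr (_ * - _).
have -> : e1 x = s * (c * X x - d * Y x) - ((1 - x * c) * X' x + x * d * Y' x).
  by rewrite ode1; ring.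
have -> // : e2 x = s * (c * Y x + d * X x) - ((1 - x * c) * Y' x - x * d * X' x).
by rewrite ode2; ring.
Qed.

Lemma unwind_binom r n : 0 <= r < 1 -> (0 < n)%N ->
  `|unwind_re (binom_re n) (binom_im n) r - 1| <= unwind_rate r * r ^+ n /\
  `|unwind_re (binom_im n) (fun t => - binom_re n t) r| <= unwind_rate r * r ^+ n.
Proof.
move=> r01 n0; have [s0 s1] := andP s01.
have at0 (f : nat -> R) : pow_sum n f 0 = f 0%N.
  rewrite /pow_sum; case: n n0 => // m _.
  by rewrite big_ord_recl big1 /= ?mulr1 ?addr0// => i _; rewrite expr0n mulr0.
have X0 : binom_re n 0 = 1 by rewrite /binom_re at0 /= mul0r cos0 mul1r.
have Y0 : binom_im n 0 = 0 by rewrite /binom_im at0 /= mul0r sin0 mulr0.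
have be (x v : R) : 0 <= x <= r -> `|v| <= 1 ->
  `|n%:R * rising_coef s n * x ^+ n.-1 * v| <= n%:R * x ^+ n.-1.
  move=> /andP[x0 _] v1; rewrite !normrM normr_nat (ger0_norm (exprn_ge0 _ x0)).
  have /andP[a0 a1] := rising_coef_bounds n s0 s1.
  rewrite -[leRHS]mulr1 ler_pM ?mulr_ge0 ?exprn_ge0// ler_wpM2r ?exprn_ge0//.
  by rewrite ler_piMr// ger0_norm.
have hX (x : R) : 0 <= x <= r -> is_derive x 1 (binom_re n) (dbinom_re n x).
  by move=> _; exact: is_derive_pow_sum.
have hY (x : R) : 0 <= x <= r -> is_derive x 1 (binom_im n) (dbinom_im n x).
  by move=> _; exact: is_derive_pow_sum.
pose e1 x := n%:R * rising_coef s n * x ^+ n.-1 * cos (n%:R * theta).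
pose e2 x := n%:R * rising_coef s n * x ^+ n.-1 * sin (n%:R * theta).
split.
- rewrite -X0; apply: (@unwind_re_bound r n _ _ (dbinom_re n) (dbinom_im n) e1 e2) => //.
  + by move=> x; have [] := binom_ode n x.
  + by move=> x; have [] := binom_ode n x.
  + by move=> x xr; apply: be => //; exact: cos_max.
  + by move=> x xr; apply: be => //; exact: sin_max.
- rewrite -[unwind_re _ _ r]subr0 -Y0.
  apply: (@unwind_re_bound r n _ _ (dbinom_im n) (fun x => - dbinom_re n x)
     e2 (fun x => - e1 x)) => //.
  + by move=> x xr; exact: is_deriveN (hX x xr).
  + move=> x; have [_ h] := binom_ode n x; rewrite -/(e2 x) in h.
    transitivity ((1 - x * c) * dbinom_im n x - x * d * dbinom_re n x); first by ring.
    by rewrite h /e2; ring.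
  + move=> x; have [h _] := binom_ode n x; rewrite -/(e1 x) in h.
    apply: oppr_inj.
    transitivity ((1 - x * c) * dbinom_re n x + x * d * dbinom_im n x); first by ring.
    by rewrite h; ring.
  + by move=> x xr; apply: be => //; exact: sin_max.
  + by move=> x xr; rewrite normrN; apply: be => //; exact: cos_max.
Qed.

(** Real and imaginary parts of (1 - z)^(-s) in polar form, at
    z = r exp (i theta). *)
Definition closed_re r := (sqdist r `^ (s / 2))^-1 * cos (s * phase r).
Definition closed_im r := (sqdist r `^ (s / 2))^-1 * sin (s * phase r).
(** The factor 48 is 2 * 24: both components of F_n (1 - z)^s - 1 enter each
    component of F_n. *)
Definition binom_rate r : R := 48 / (1 - r) ^+ 4.

(** Dividing the estimate on F_n (1 - z)^s - 1 by (1 - z)^s costs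
    |1 - z|^(-s) <= (1 - r)^(-2).  The bound does not depend on the angle, so
    one truncation serves all frequencies. *)
Lemma binom_closed_form r n : 0 <= r < 1 -> (0 < n)%N ->
  `|binom_re n r - closed_re r| <= binom_rate r * r ^+ n /\
  `|binom_im n r - closed_im r| <= binom_rate r * r ^+ n.
Proof.
move=> r01 n0; have [] := unwind_binom r01 n0.
have [r0 r1] := andP r01.
have q0 : 0 < (1 - r) ^+ 2 by rewrite exprn_gt0// subr_gt0.
have /andP[lo _] : (1 - r) ^+ 2 <= sqdist r `^ (s / 2) <= 4.
  by apply: sqdist_powR_bounds r1; rewrite r0 lexx.
rewrite /unwind_re /closed_re /closed_im.
move: (sqdist r `^ (s / 2)) lo => E lo.
have E0 : 0 < E by exact: lt_le_trans lo.
set x := s * phase r; set X := binom_re n r; set Y := binom_im n r.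
have cs : cos x ^+ 2 + sin x ^+ 2 = 1 by exact: cos2Dsin2.
set F1 := E * (cos x * X + sin x * Y) - 1.
set F2 := E * (cos x * Y + sin x * - X).
move=> h1 h2.
have Ei : `|E^-1| <= ((1 - r) ^+ 2)^-1.
  by rewrite ger0_norm ?invr_ge0 ?(ltW E0)// lef_pV2.
have rate : binom_rate r * r ^+ n =
  ((1 - r) ^+ 2)^-1 * (unwind_rate r * r ^+ n + unwind_rate r * r ^+ n).
  rewrite /binom_rate /unwind_rate; field.
  by rewrite subr_eq0 gt_eqF.
have E0' := lt0r_neq0 E0.
have eX : X - E^-1 * cos x = E^-1 * (cos x * F1 + sin x * (- F2)).
  rewrite -[X in X - _]mul1r -cs /F1 /F2; field.
  by [].
have eY : Y - E^-1 * sin x = E^-1 * (cos x * F2 + sin x * F1).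
  rewrite -[Y in Y - _]mul1r -cs /F1 /F2; field.
  by [].
rewrite rate eX eY; split; rewrite normrM; apply: ler_pM => //.
  by apply: trig_combination_le => //; rewrite normrN.
by apply: trig_combination_le.
Qed.

End ClosedForm.

(** * The sector containing the symbol *)

Section Sector.
Variable R : realType.
Implicit Types (p r s theta x psi : R).

(** Equality holds at 0, and the derivative of the difference is proportional
    to cos (p theta) - cos ((1 - p) theta), which is nonnegative as
    p <= 1 - p.  Geometrically, the argument of 1 - p + p exp (i theta) is at
    most p theta. *)
Lemma sin_chord_ineq p theta : 0 <= p <= 1 / 2 -> 0 <= theta <= pi ->
  p * sin ((1 - p) * theta) <= (1 - p) * sin (p * theta).
Proof.
move=> /andP[p0 p1] /andP[t0 tpi].
have dsin a (x : R) : is_derive x 1 (fun y => sin (y * a)) (cos (x * a) * a).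
  have h : is_derive x 1 (fun y => y * a) a.
    by have := is_derive_affine 0 a x; under eq_fun do rewrite add0r.
  exact: (@is_derive1_comp R sin (fun y => y * a) x _ _ (is_derive_sin _) h).
pose h y := (1 - p) * sin (y * p) + (- p) * sin (y * (1 - p)).
pose dh y := (1 - p) * p * (cos (y * p) - cos (y * (1 - p))).
have hd (x : R) : is_derive x 1 h (dh x).
  have := is_derive_addf
    (is_derive_mulf (is_derive_cst (1 - p : R^o) x 1) (dsin p x))
    (is_derive_mulf (is_derive_cst (- p : R^o) x 1) (dsin (1 - p) x)).
  by move=> H; apply: (is_derive_eq H); rewrite /dh /=; ring.
have : `|(cst 0 : R -> R) theta - (cst 0 : R -> R) 0| <= h theta - h 0.
  apply: (@mean_value_le R _ h (fun=> 0) dh 0 theta t0) => //.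
  move=> x /andP[x0 xt]; rewrite normr0 /dh mulr_ge0//; first by rewrite mulr_ge0//; lra.
  rewrite subr_ge0 leNgt ltr_cos ?in_itv/=; first last.
  - by apply/andP; split; nra.
  - by apply/andP; split; nra.
  by rewrite -leNgt ler_wpM2l//; lra.
rewrite /= subrr normr0 /h !mul0r sin0 !mulr0 addr0 subr0.
by rewrite [theta * p]mulrC [theta * (1 - p)]mulrC mulNr subr_ge0.
Qed.

(** The argument of 1 / (1 - r exp (i theta)) increases with r, and at r = 1 it
    is half of pi - theta. *)
Lemma phase_bounds theta r : 0 <= theta <= pi -> 0 <= r < 1 ->
  0 <= phase theta r /\ 2 * phase theta r <= pi - theta.
Proof.
move=> /andP[t0 tpi] /andP[r0 r1].
have q0 : 0 < 1 - r * cos theta by apply: one_sub_cos_gt0; rewrite r0.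
have d0 : 0 <= sin theta by rewrite sin_ge0_pi// t0.
rewrite /phase; set v := r * sin theta / (1 - r * cos theta).
have v0 : 0 <= v by rewrite divr_ge0 ?mulr_ge0// ltW.
have [w1 w2] := andP (atan_def v).1.
have tw := atanK v; set w := atan v in w1 w2 tw *.
have cw : 0 < cos w by apply: cos_gt0_pihalf; rewrite w1.
have sw : sin w = v * cos w by rewrite -tw /tan divfK// gt_eqF.
split.
  rewrite leNgt; apply/negP => w_lt0.
  have : 0 < sin (- w) by apply: sin_gt0_pihalf; rewrite oppr_gt0 w_lt0/= ltrNl.
  by rewrite sinN sw oppr_gt0 ltNge mulr_ge0 ?(ltW cw).
rewrite leNgt; apply/negP => lt_w.
have pi0 := pi_gt0 R.
have : 0 < sin (w - (pi / 2 - theta / 2)).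
  by apply: sin_gt0_pi; apply/andP; split; lra.
have -> : w - (pi / 2 - theta / 2) = (w + theta / 2) - pi / 2 by ring.
rewrite sinBpihalf cosD sw oppr_gt0 ltNge => /negP; apply.
have -> : cos w * cos (theta / 2) - v * cos w * sin (theta / 2) =
  cos w / (1 - r * cos theta) * ((1 - r) * cos (theta / 2)).
  have e1 : cos theta = cos (theta / 2) ^+ 2 - sin (theta / 2) ^+ 2.
    by rewrite {1}(splitr theta) cosD; ring.
  have e2 : sin theta = 2 * (sin (theta / 2) * cos (theta / 2)).
    by rewrite {1}(splitr theta) sinD; ring.
  have e3 := cos2Dsin2 (theta / 2).
  have -> : v * cos w * sin (theta / 2) = cos w / (1 - r * cos theta) *
     (r * sin theta * sin (theta / 2)) by rewrite /v; ring.
  have -> : cos w * cos (theta / 2) = cos w / (1 - r * cos theta) *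
     ((1 - r * cos theta) * cos (theta / 2)) by field; rewrite gt_eqF.
  rewrite -mulrBr; congr (_ * _); rewrite e2 e1.
  transitivity ((1 - r * (cos (theta / 2) ^+ 2 + sin (theta / 2) ^+ 2)) * cos (theta / 2)).
    by ring.
  by rewrite e3 mulr1.
apply: mulr_ge0; first by rewrite divr_ge0 ?ltW.
apply: mulr_ge0; first by lra.
by apply: cos_ge0_pihalf; apply/andP; split; lra.
Qed.

(** Real and imaginary parts of K(z) = (1 - z)^(-s) (1 - s/2 + (s/2) z). *)
Definition symbol_re s theta r := (1 - s / 2) * closed_re s theta r +
  s / 2 * r * (cos theta * closed_re s theta r - sin theta * closed_im s theta r).
Definition symbol_im s theta r := (1 - s / 2) * closed_im s theta r +
  s / 2 * r * (cos theta * closed_im s theta r + sin theta * closed_re s theta r).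

(** For theta in [0, pi] the argument of K lies in [0, p pi], p = s/2: the factor
    (1 - z)^(-s) contributes at most p (pi - theta) by [phase_bounds], and the
    affine factor at most p theta by [sin_chord_ineq].  The proof avoids
    arguments: it shows that Im K and Im (K conj (exp (i p pi))) have the
    signs that place K in this cone. *)
Lemma symbol_sector s theta r : 0 < s <= 1 -> 0 <= theta <= pi -> 0 <= r < 1 ->
  0 <= symbol_re s theta r /\
  cos (s / 2 * pi) ^+ 2 * (symbol_re s theta r ^+ 2 + symbol_im s theta r ^+ 2) <=
    symbol_re s theta r ^+ 2.
Proof.
move=> /andP[s0 s1] tb rb; have [w0 wle] := phase_bounds tb rb.
have [t0 tpi] := andP tb; have [r0 r1] := andP rb; have pi0 := pi_gt0 R.
have d0 : 0 <= sin theta by rewrite sin_ge0_pi.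
rewrite /symbol_re /symbol_im /closed_re /closed_im.
have E0 : 0 < (sqdist theta r `^ (s / 2))^-1.
  by rewrite invr_gt0 powR_gt0// sqdist_gt0.
move: (_^-1) E0 => E E0.
set w := phase theta r in w0 wle *; set c := cos theta; set d := sin theta in d0 *.
set p := s / 2; have p0 : 0 < p by rewrite /p; lra.
have p1 : p <= 1 / 2 by rewrite /p; lra.
pose Wr := 1 - p + p * r * c; pose Wi := p * r * d.
set KR := (X in 0 <= X); set KI := (X in KR ^+ 2 + X ^+ 2).
have eR : KR = E * (cos (s * w) * Wr - sin (s * w) * Wi).
  by rewrite /KR /Wr /Wi -/w; ring.
have eI : KI = E * (cos (s * w) * Wi + sin (s * w) * Wr).
  by rewrite /KI /Wr /Wi -/w; ring.
have Wi0 : 0 <= Wi by rewrite !mulr_ge0// ltW.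
have Wr0 : 0 <= Wr.
  have : - (p * r) <= p * r * c.
    by rewrite -[- _]mulrN1 ler_wpM2l ?cos_geN1// mulr_ge0// ltW.
  have : p * r <= p by rewrite ler_piMr// ltW.
  by rewrite /Wr; lra.
have pt : 0 <= p * theta <= pi / 2 by apply/andP; split; nra.
have spt : 0 <= sin (p * theta).
  by apply: sin_ge0_pi; have /andP[h1 h2] := pt; apply/andP; split; lra.
have cpt : 0 <= cos (p * theta).
  by apply: cos_ge0_pihalf; have /andP[h1 h2] := pt; apply/andP; split; lra.
have es : s = 2 * p by rewrite /p; field.
have swb : 0 <= s * w <= pi / 2.
  by rewrite es; apply/andP; split; nra.
have sw0 : 0 <= sin (s * w).
  by apply: sin_ge0_pi; have /andP[h1 h2] := swb; apply/andP; split; lra.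
have cw0 : 0 <= cos (s * w).
  by apply: cos_ge0_pihalf; have /andP[h1 h2] := swb; apply/andP; split; lra.
have KI0 : 0 <= KI by rewrite eI mulr_ge0 ?(ltW E0)// addr_ge0// mulr_ge0.
(* The argument of the affine factor W is at most p theta. *)
have base : 0 <= Wr * sin (p * theta) - Wi * cos (p * theta).
  have -> : Wr * sin (p * theta) - Wi * cos (p * theta) =
    (1 - p) * sin (p * theta) - p * r * sin ((1 - p) * theta).
    have -> : (1 - p) * theta = theta - p * theta by ring.
    by rewrite sinB /Wr /Wi -/c -/d; ring.
  rewrite subr_ge0 (le_trans _ (sin_chord_ineq _ tb))//; last by rewrite (ltW p0).
  rewrite ler_wpM2r//; last by rewrite ler_piMr// ltW.
  by apply: sin_ge0_pi; apply/andP; split; nra.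
pose delta := p * (pi - theta - 2 * w).
have deltab : 0 <= delta <= pi / 2 by apply/andP; split; rewrite /delta; nra.
(* Rotating exp (- i p theta) W further by - delta keeps it in the lower half
   plane, since its real part is nonnegative and delta is at most pi / 2. *)
have cone : 0 <= sin (p * pi) * KR - cos (p * pi) * KI.
  have -> : sin (p * pi) * KR - cos (p * pi) * KI =
     E * (Wr * sin (p * pi - s * w) - Wi * cos (p * pi - s * w)).
    by rewrite eR eI sinB cosB; ring.
  have -> : p * pi - s * w = delta + p * theta by rewrite /delta es; ring.
  have -> : Wr * sin (delta + p * theta) - Wi * cos (delta + p * theta) =
    cos delta * (Wr * sin (p * theta) - Wi * cos (p * theta)) +
    sin delta * (Wr * cos (p * theta) + Wi * sin (p * theta)).
    by rewrite sinD cosD; ring.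
  have /andP[h1 h2] := deltab.
  rewrite mulr_ge0 ?(ltW E0)// addr_ge0// mulr_ge0//.
  - by apply: cos_ge0_pihalf; apply/andP; split; lra.
  - by apply: sin_ge0_pi; apply/andP; split; lra.
  - by rewrite addr_ge0// mulr_ge0.
have spi : 0 < sin (p * pi) by apply: sin_gt0_pi; apply/andP; split; nra.
have cpi : 0 <= cos (p * pi) by apply: cos_ge0_pihalf; apply/andP; split; nra.
have KR0 : 0 <= KR.
  rewrite -(pmulr_rge0 _ spi); apply: (@le_trans _ _ (cos (p * pi) * KI)).
    by rewrite mulr_ge0.
  by rewrite -subr_ge0.
split=> //; have e := cos2Dsin2 (p * pi).
have : (cos (p * pi) * KI) ^+ 2 <= (sin (p * pi) * KR) ^+ 2.
  by rewrite ler_pXn2r ?nnegrE ?mulr_ge0 ?(ltW spi)// -subr_ge0.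
rewrite !exprMn; have -> : sin (p * pi) ^+ 2 = 1 - cos (p * pi) ^+ 2 by rewrite -e; ring.
by move: (cos (p * pi) ^+ 2) (KR ^+ 2) (KI ^+ 2) => x y z; lra.
Qed.

(** The left side is 2 z Re (K U conj V) <= 2 z |K| |U| |V|, the sector condition
    turns z |K| into Re K, and 2 |U| |V| <= |U|^2 + |V|^2. *)
Lemma sector_pointwise (z KR KI Uc Us Vc Vs : R) : 0 <= z -> 0 <= KR ->
  z ^+ 2 * (KR ^+ 2 + KI ^+ 2) <= KR ^+ 2 ->
  2 * z * (KR * (Uc * Vc + Us * Vs) - KI * (Us * Vc - Uc * Vs)) <=
  KR * (Uc * Uc + Us * Us) + KR * (Vc * Vc + Vs * Vs).
Proof.
move=> z0 K0 h; rewrite -mulrDr.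
set P := Uc * Uc + Us * Us; set Q := Vc * Vc + Vs * Vs.
set A := Uc * Vc + _; set B := Us * Vc - _.
have P0 : 0 <= P by rewrite addr_ge0// -expr2 sqr_ge0.
have Q0 : 0 <= Q by rewrite addr_ge0// -expr2 sqr_ge0.
have AB : A ^+ 2 + B ^+ 2 = P * Q by rewrite /A /B /P /Q; ring.
set L := KR * A - KI * B.
have cs : L ^+ 2 <= (KR ^+ 2 + KI ^+ 2) * (P * Q).
  rewrite -AB -subr_ge0 (_ : _ - _ = (KR * B + KI * A) ^+ 2) ?sqr_ge0//.
  by rewrite /L; ring.
have rhs0 : 0 <= KR * (P + Q) by rewrite mulr_ge0// addr_ge0.
apply: le_trans (ler_norm _) _; rewrite -ler_sqr ?nnegrE// real_normK ?num_real//.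
apply: (@le_trans _ _ (4 * (KR ^+ 2 * (P * Q)))).
  have -> : (2 * z * L) ^+ 2 = 4 * (z ^+ 2 * L ^+ 2) by ring.
  rewrite ler_pM2l//; apply: (@le_trans _ _ (z ^+ 2 * ((KR ^+ 2 + KI ^+ 2) * (P * Q)))).
    by rewrite ler_wpM2l// sqr_ge0.
  by rewrite mulrA ler_wpM2r// mulr_ge0.
rewrite -subr_ge0 (_ : _ - _ = (KR * (P - Q)) ^+ 2) ?sqr_ge0//; ring.
Qed.

End Sector.

(** * The sector property at a fixed frequency *)

Section ToeplitzSector.
Variables (R : realType) (s : R).
Hypothesis s01 : 0 < s <= 1.
Implicit Types (r theta : R) (n M : nat).

(** The Taylor coefficients of K at 0. *)
Definition kernel_coef (n : nat) : R := times_affine (s / 2) (rising_coef s) n.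
(** The Taylor coefficients of K(r z).  For r < 1 they decay geometrically,
    which the truncation of the series requires. *)
Definition damped_kernel r (n : nat) : R := kernel_coef n * r ^+ n.

(** The coefficients of K mix those of (1 - z)^(-s) with their shift; the shift
    is a multiplication by z, a rotation by theta scaled by r. *)
Lemma kernel_sums theta r n :
  cos_sum (fun j : 'I_n.+1 => damped_kernel r j) theta =
    (1 - s / 2) * binom_re s theta n.+1 r +
    s / 2 * r * (cos theta * binom_re s theta n r - sin theta * binom_im s theta n r) /\
  sin_sum (fun j : 'I_n.+1 => damped_kernel r j) theta =
    (1 - s / 2) * binom_im s theta n.+1 r +
    s / 2 * r * (cos theta * binom_im s theta n r + sin theta * binom_re s theta n r).
Proof.
rewrite /cos_sum /sin_sum /binom_re /binom_im /pow_sum /damped_kernel /kernel_coef.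
have succ_angle (j : nat) : j.+1%:R * theta = j%:R * theta + theta.
  by rewrite -natr1 mulrDl mul1r.
split.
- rewrite 2!big_ord_recl mulrDr -addrA; congr (_ + _).
    by rewrite [times_affine _ _ _]/= /=; ring.
  rewrite !mulr_sumr -sumrB mulr_sumr -big_split; apply: eq_bigr => j _.
  rewrite lift0 succ_angle cosD exprS [times_affine _ _ _]/times_affine.
  by move: (rising_coef s j.+1) => a; rewrite /=; ring.
- rewrite 2!big_ord_recl mulrDr -addrA; congr (_ + _).
    by rewrite [times_affine _ _ _]/= /=; ring.
  rewrite !mulr_sumr -big_split mulr_sumr -big_split; apply: eq_bigr => j _.
  rewrite lift0 succ_angle sinD exprS [times_affine _ _ _]/times_affine.
  by move: (rising_coef s j.+1) => a; rewrite /=; ring.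
Qed.

Lemma affine_perturbation (p r c d D x y x' y' a a' : R) n :
  0 <= p <= 1 / 2 -> 0 <= r < 1 -> `|c| <= 1 -> `|d| <= 1 ->
  0 <= D -> `|a - a'| <= D * r ^+ n.+1 -> `|x - x'| <= D * r ^+ n ->
  `|y - y'| <= D * r ^+ n ->
  `|((1 - p) * a + p * r * (c * x + d * y)) -
    ((1 - p) * a' + p * r * (c * x' + d * y'))| <= 2 * D * r ^+ n.
Proof.
move=> /andP[p0 p1] /andP[r0 r1] hc hd D0 ha hx hy.
have -> : ((1 - p) * a + p * r * (c * x + d * y)) -
    ((1 - p) * a' + p * r * (c * x' + d * y')) =
    (1 - p) * (a - a') + p * r * (c * (x - x') + d * (y - y')) by ring.
set q := D * r ^+ n in hx hy; have q0 : 0 <= q by rewrite mulr_ge0// exprn_ge0.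
have ha' : `|a - a'| <= q.
  apply: le_trans ha _; rewrite exprS [D * _]mulrCA; exact: ler_piMl q0 (ltW r1).
apply: le_trans (ler_normD _ _) _.
have p1' : 0 <= 1 - p by lra.
have pr0 : 0 <= p * r by rewrite mulr_ge0.
rewrite (normrM (1 - p)) (normrM (p * r)) (ger0_norm p1') (ger0_norm pr0).
have h1 : (1 - p) * `|a - a'| <= (1 - p) * q by rewrite ler_wpM2l.
have h2 : `|c * (x - x') + d * (y - y')| <= 1 * q + 1 * q.
  by apply: le_trans (ler_normD _ _) _; rewrite !normrM lerD// ler_pM.
have h3 : p * r <= p by rewrite ler_piMr// ltW.
have h4 : p * r * `|c * (x - x') + d * (y - y')| <= p * (1 * q + 1 * q).
  by rewrite ler_pM.
apply: le_trans (lerD h1 h4) _; rewrite -mulrA -/q.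
have : p * q <= 1 / 2 * q by rewrite ler_wpM2r.
by lra.
Qed.

Lemma kernel_sums_approx theta r n : 0 <= theta <= pi -> 0 <= r < 1 -> (0 < n)%N ->
  `|cos_sum (fun j : 'I_n.+1 => damped_kernel r j) theta - symbol_re s theta r|
    <= 2 * binom_rate r * r ^+ n /\
  `|sin_sum (fun j : 'I_n.+1 => damped_kernel r j) theta - symbol_im s theta r|
    <= 2 * binom_rate r * r ^+ n.
Proof.
move=> tb rb n0; have [s0 s1] := andP s01; have [r0 r1] := andP rb.
have s01' : 0 <= s <= 1 by rewrite ltW.
have pb : 0 <= s / 2 <= 1 / 2 by apply/andP; split; lra.
have [hr hi] := binom_closed_form theta s01' rb n0.
have [hr' hi'] := binom_closed_form theta s01' rb (ltn0Sn n).
have D0 : 0 <= binom_rate r :> R.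
  by rewrite divr_ge0// exprn_ge0// subr_ge0 ltW.
have [-> ->] := kernel_sums theta r n; rewrite /symbol_re /symbol_im.
split; last first.
  exact: affine_perturbation pb rb (cos_max theta) (sin_max theta) D0 hi' hi hr.
have sN : `|- sin theta| <= 1 by rewrite normrN sin_max.
have := affine_perturbation pb rb (cos_max theta) sN D0 hr' hr hi.
by rewrite !mulNr.
Qed.

Lemma cos_sin_sum_le M (u : 'I_M -> R) theta :
  `|cos_sum u theta| <= \sum_a `|u a| /\ `|sin_sum u theta| <= \sum_a `|u a|.
Proof.
split; apply: le_trans (ler_norm_sum _ _ _) _; apply: ler_sum => a _;
  rewrite normrM ler_piMr//; [exact: cos_max|exact: sin_max].
Qed.

(** The form is the real part of a product of functions that are conjugated by
    theta -> - theta.  This reduces all frequencies to [0, pi]. *)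
Lemma spectral_form_reflect n M (k : 'I_n -> R) (v u : 'I_M -> R) theta :
  spectral_form k v u (2 * pi - theta) = spectral_form k v u theta.
Proof.
have e (j : nat) : j%:R * (2 * pi - theta) = - (j%:R * theta) + pi *+ 2 *+ j.
  by rewrite -[pi *+ 2]mulr_natl -(mulr_natl _ j); ring.
have ec m (f : 'I_m -> R) : cos_sum f (2 * pi - theta) = cos_sum f theta.
  apply: eq_bigr => j _; rewrite e (periodicn (@cosD2pi R)) cosN //.
have es m (f : 'I_m -> R) : sin_sum f (2 * pi - theta) = - sin_sum f theta.
  rewrite /sin_sum -sumrN; apply: eq_bigr => j _.
  by rewrite e (periodicn (@sinD2pi R)) sinN mulrN.
rewrite /spectral_form !ec !es; ring.
Qed.

(** The factor of the truncation error in [spectral_sector]; what matters is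
    that it depends neither on the frequency nor on the truncation order. *)
Definition sector_defect r M (v u : 'I_M -> R) : R :=
  32 * binom_rate r * (\sum_a `|u a| + \sum_a `|v a|) ^+ 2.

(** The inequality holds exactly for the symbol by [sector_pointwise]; each of
    the three forms changes by at most 4 L^2 times the error of the truncated
    symbol, where L bounds the transforms of u and v. *)
Lemma spectral_sector theta r n M (v u : 'I_M -> R) :
  0 <= theta <= 2 * pi -> 0 <= r < 1 -> (0 < n)%N ->
  2 * cos (s / 2 * pi) *
    spectral_form (fun j : 'I_n.+1 => damped_kernel r j) v u theta <=
  spectral_form (fun j : 'I_n.+1 => damped_kernel r j) u u theta +
  spectral_form (fun j : 'I_n.+1 => damped_kernel r j) v v theta +
  sector_defect r v u * r ^+ n.
Proof.
move=> tb rb n0.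
wlog tb' : theta tb / 0 <= theta <= pi => [H|].
  have [t0 t2] := andP tb; have [tpi|tpi] := leP theta pi; first by apply: H; rewrite ?t0.
  by rewrite -3!(spectral_form_reflect _ _ _ theta); apply: H; apply/andP; split; lra.
set k := fun j : 'I_n.+1 => damped_kernel r j.
have [h1 h2] := kernel_sums_approx tb' rb n0.
have [r0 r1] := andP rb; have [s0 s1] := andP s01.
have [K0 sec] := symbol_sector s01 tb' rb.
set z := cos (s / 2 * pi) in sec *.
have z0 : 0 <= z.
  apply: cos_ge0_pihalf; have := pi_ge0 R; move: (pi : R) => x x0.
  by apply/andP; split; nra.
have z1 : z <= 1 by exact: cos_le1.
have [uc us] := cos_sin_sum_le u theta.
have [vc vs] := cos_sin_sum_le v theta.
rewrite /spectral_form -/k in h1 h2 *.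
set L := \sum_a `|u a| + \sum_a `|v a|.
have L1 : \sum_a `|u a| <= L by rewrite lerDl sumr_ge0.
have L2 : \sum_a `|v a| <= L by rewrite lerDr sumr_ge0.
move: (le_trans uc L1) (le_trans us L1) (le_trans vc L2) (le_trans vs L2).
move: (cos_sum u theta) (sin_sum u theta) (cos_sum v theta) (sin_sum v theta).
move=> Uc Us Vc Vs {uc us vc vs} uc us vc vs.
have := sector_pointwise Uc Us Vc Vs z0 K0 sec.
move: (cos_sum k theta) (sin_sum k theta) (symbol_re s theta r)
  (symbol_im s theta r) h1 h2 => KR' KI' KR KI h1 h2 {K0 sec} exact_ineq.
set q := 2 * binom_rate r * r ^+ n in h1 h2.
have bound (a b a' b' : R) : `|a| <= L -> `|b| <= L -> `|a'| <= L -> `|b'| <= L ->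
    `|(KR' * (a * a' + b * b') - KI' * (b * a' - a * b')) -
      (KR * (a * a' + b * b') - KI * (b * a' - a * b'))| <= q * (4 * L ^+ 2).
  move=> ha hb ha' hb'.
  have -> : (KR' * (a * a' + b * b') - KI' * (b * a' - a * b')) -
      (KR * (a * a' + b * b') - KI * (b * a' - a * b')) =
      (KR' - KR) * (a * a' + b * b') - (KI' - KI) * (b * a' - a * b') by ring.
  have m x y : `|x| <= L -> `|y| <= L -> `|x * y| <= L ^+ 2.
    by move=> hx hy; rewrite normrM expr2 ler_pM.
  have m1 : `|a * a' + b * b'| <= L ^+ 2 + L ^+ 2.
    by apply: le_trans (ler_normD _ _) _; rewrite lerD// m.
  have m2 : `|b * a' - a * b'| <= L ^+ 2 + L ^+ 2.
    by apply: le_trans (ler_normB _ _) _; rewrite lerD// m.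
  apply: le_trans (ler_normB _ _) _.
  have -> : q * (4 * L ^+ 2) = q * (L ^+ 2 + L ^+ 2) + q * (L ^+ 2 + L ^+ 2) by ring.
  by rewrite (normrM (KR' - KR)) (normrM (KI' - KI)) lerD// ler_pM.
have := bound _ _ _ _ uc us vc vs; have := bound _ _ _ _ uc us uc us.
have := bound _ _ _ _ vc vs vc vs.
have -> : sector_defect r v u * r ^+ n = 4 * (q * (4 * L ^+ 2)).
  by rewrite /sector_defect -/L /q; ring.
rewrite !ler_norml => /andP[a1 a2] /andP[b1 b2] /andP[c1 c2].
move: (q * _) a1 a2 b1 b2 c1 c2 => e a1 a2 b1 b2 c1 c2.
have e0 : 0 <= e by lra.
have c3 : z * ((KR' * (Uc * Vc + Us * Vs) - KI' * (Us * Vc - Uc * Vs)) -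
      (KR * (Uc * Vc + Us * Vs) - KI * (Us * Vc - Uc * Vs))) <= e.
  by apply: (@le_trans _ _ (z * e)); [rewrite ler_wpM2l|rewrite ler_piMl].
move: exact_ineq a1 b1 c3.
move: (KR * (Uc * Vc + Us * Vs) - _) (KR' * (Uc * Vc + Us * Vs) - _) => X X'.
have -> : KR * (Uc * Uc + Us * Us) - KI * (Us * Uc - Uc * Us) =
  KR * (Uc * Uc + Us * Us) by ring.
have -> : KR * (Vc * Vc + Vs * Vs) - KI * (Vs * Vc - Vc * Vs) =
  KR * (Vc * Vc + Vs * Vs) by ring.
move: (KR * _) (KR * _) (KR' * _ - _) (KR' * _ - _) => Y Z Y' Z'; lra.
Qed.

End ToeplitzSector.

(** * The sector property of the Toeplitz form *)

Section ToeplitzLimit.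
Variables (R : realType) (s : R).
Hypothesis s01 : 0 < s <= 1.
Implicit Types (r : R) (M : nat).

Lemma le0_of_geometric_bound (x C r : R) n0 : 0 <= r < 1 ->
  (forall n, (n0 <= n)%N -> x <= C * r ^+ n) -> x <= 0.
Proof.
move=> /andP[r0 r1] h.
have cv : (C * r ^+ n @[n --> \oo]) --> (0 : R).
  rewrite -[X in _ --> X](mulr0 C); apply: cvgMr.
  by apply: cvg_expr; rewrite ger0_norm.
apply: (cvgr_to_ge cv); near=> n; apply: h; near: n; exact: nbhs_infty_ge.
Unshelve. all: by end_near. Qed.

(** Average [spectral_sector] over the frequencies with the weight
    |1 - z|^2 <= 4, which turns the spectral forms into Toeplitz forms, and let
    the truncation order tend to infinity. *)
Lemma toeplitz_sector_damped r M (v u : 'I_M -> R) : 0 <= r < 1 ->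
  - (2 * cos (s / 2 * pi)) * toeplitz_form (second_diff (damped_kernel s r)) v u <=
  - toeplitz_form (second_diff (damped_kernel s r)) u u
  - toeplitz_form (second_diff (damped_kernel s r)) v v.
Proof.
move=> rb; rewrite -subr_le0.
apply: (@le0_of_geometric_bound _ (4 * sector_defect r v u) r M.+1 rb) => n Mn.
(* N exceeds every frequency of the weighted symbol: the average is exact. *)
pose N := (n.+1 + M).+1.
have N0 : 0 < N%:R :> R by rewrite ltr0n.
have Mn1 : (M < n.+1)%N by apply: leq_trans Mn _.
have nN : (n.+1 + M < N)%N by [].
have pi0 := pi_gt0 R.
have D0 : 0 <= sector_defect r v u.
  have [r0 r1] := andP rb.
  rewrite mulr_ge0 ?sqr_ge0// mulr_ge0// divr_ge0// exprn_ge0// subr_ge0 ltW//.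
have := @ler_sum R _ (index_enum 'I_N) xpredT
  (fun m : 'I_N => (2 - 2 * cos (dft_node R N m)) *
    (2 * cos (s / 2 * pi) *
      spectral_form (fun j : 'I_n.+1 => damped_kernel s r j) v u (dft_node R N m)))
  (fun m : 'I_N => (2 - 2 * cos (dft_node R N m)) *
    spectral_form (fun j : 'I_n.+1 => damped_kernel s r j) u u (dft_node R N m) +
    (2 - 2 * cos (dft_node R N m)) *
    spectral_form (fun j : 'I_n.+1 => damped_kernel s r j) v v (dft_node R N m) +
    4 * (sector_defect r v u * r ^+ n)).
rewrite !big_split /= !(sum_spectral_form (damped_kernel s r) _ _ Mn1 nN).
rewrite sumr_const card_ord -[(4 * _) *+ N]mulr_natl.
under eq_bigr do rewrite mulrCA.
rewrite -mulr_sumr (sum_spectral_form (damped_kernel s r) _ _ Mn1 nN) => H.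
rewrite -(ler_pM2l N0) -subr_ge0; move: H; rewrite -subr_ge0.
set a := toeplitz_form _ _ _; set b := toeplitz_form _ _ _; set c := toeplitz_form _ _ _.
set z := cos (s / 2 * pi) => H.
apply: le_trans (H _) _; last by rewrite le_eqVlt; apply/orP; left; apply/eqP; ring.
move=> m _; set t := dft_node R N m.
have tb : 0 <= t <= 2 * pi.
  rewrite /t /dft_node; apply/andP; split.
    by rewrite divr_ge0// !mulr_ge0// ltW.
  rewrite ler_pdivrMr// ler_wpM2l//; first by rewrite mulr_ge0// ltW.
  by rewrite ler_nat ltnW.
have wt0 : 0 <= 2 - 2 * cos t by have := cos_le1 t; lra.
have wt4 : 2 - 2 * cos t <= 4 by have := cos_geN1 t; lra.
have n_gt0 : (0 < n)%N by apply: leq_trans Mn.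
have h := spectral_sector s01 v u tb rb n_gt0.
apply: le_trans (ler_wpM2l wt0 h) _.
rewrite !mulrDr lerD2l ler_wpM2r// mulr_ge0// exprn_ge0//.
by have [] := andP rb.
Qed.

Lemma second_diff_damped_cvg n :
  (second_diff (damped_kernel s r) n @[r --> (1 : R)]) --> second_diff (kernel_coef s) n.
Proof.
have h j : (damped_kernel s r j @[r --> (1 : R)]) --> kernel_coef s j.
  rewrite (_ : kernel_coef s j = kernel_coef s j * 1 ^+ j); last by rewrite expr1n mulr1.
  by apply: cvgMr; exact: exprn_continuous.
case: n => [|[|n]]; first exact: h.
  by apply: cvgB (h _) _; apply: cvgMr.
by apply: cvgD (h _); apply: cvgB (h _) _; apply: cvgMr.
Qed.

Lemma toeplitz_form_damped_cvg M (v u : 'I_M -> R) :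
  (toeplitz_form (second_diff (damped_kernel s r)) v u @[r --> (1 : R)]) -->
  toeplitz_form (second_diff (kernel_coef s)) v u.
Proof.
apply: cvg_big => [|a _]; first exact: add_continuous.
apply: cvg_big => [|b _]; first exact: add_continuous.
apply: cvgMl; apply: cvgMr; case: ifP => _; last exact: cvg_cst.
exact: second_diff_damped_cvg.
Qed.

(** The radius tends to 1 in [toeplitz_sector_damped]. *)
Lemma toeplitz_sector M (v u : 'I_M -> R) :
  - (2 * cos (s / 2 * pi)) * toeplitz_form (w_coef (2 - s)) v u <=
  - toeplitz_form (w_coef (2 - s)) u u - toeplitz_form (w_coef (2 - s)) v v.
Proof.
have -> : w_coef (2 - s) = second_diff (kernel_coef s).
  by apply/funext => n; rewrite w_coef_second_diff.
rewrite -subr_le0.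
have cv : (- (2 * cos (s / 2 * pi)) * toeplitz_form (second_diff (damped_kernel s r)) v u -
   (- toeplitz_form (second_diff (damped_kernel s r)) u u
  - toeplitz_form (second_diff (damped_kernel s r)) v v) @[r --> (1 : R)^'-]) -->
   (- (2 * cos (s / 2 * pi)) * toeplitz_form (second_diff (kernel_coef s)) v u -
   (- toeplitz_form (second_diff (kernel_coef s)) u u
  - toeplitz_form (second_diff (kernel_coef s)) v v)).
  apply: cvg_at_left_filter.
  apply: cvgB; first by apply: cvgMr; exact: toeplitz_form_damped_cvg.
  by apply: cvgB; [apply: cvgN|]; exact: toeplitz_form_damped_cvg.
apply: (cvgr_to_le cv); near=> r.
rewrite subr_le0; apply: toeplitz_sector_damped; apply/andP; split.
  by near: r; apply: nbhs_left_ge.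
by near: r; apply: nbhs_left_lt.
Unshelve. all: by end_near. Qed.

End ToeplitzLimit.

(** * Multipliers of a Dirichlet form *)

Section DirichletForm.
Variable R : realType.

(** The energy of a symmetric jump rate [q], with diagonal entries [D]. *)
Definition graph_form M (D : R) (q : 'I_M -> 'I_M -> R) (u : 'I_M -> R) : R :=
  \sum_i (D * u i ^+ 2 - \sum_j q i j * u i * u j).

(** The part of the diagonal that is not balanced by jumps inside the grid. *)
Definition killing M (D : R) (q : 'I_M -> 'I_M -> R) i : R := D - \sum_j q i j.

(** A Leibniz rule, obtained by symmetrizing the pointwise identity
      (p u - p' u')^2 = p p' (u - u')^2 + (p - p') (p u^2 - p' u'^2). *)
Lemma graph_form_multiplier M D (q : 'I_M -> 'I_M -> R) (p u : 'I_M -> R) :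
  (forall i j, q i j = q j i) ->
  graph_form D q (fun i => p i * u i) =
  \sum_i \sum_j q i j * (p i * p j * (u i - u j) ^+ 2) / 2 +
  \sum_i u i ^+ 2 * (p i * (\sum_j q i j * (p i - p j)) + killing D q i * p i ^+ 2).
Proof.
move=> qC; rewrite /graph_form /killing.
have sym : \sum_i \sum_j q i j * (p i * p j * u i ^+ 2) =
           \sum_i \sum_j q i j * (p i * p j * u j ^+ 2).
  rewrite exchange_big; apply: eq_bigr => i _; apply: eq_bigr => j _.
  by rewrite qC (mulrC (p j)).
have -> : \sum_i \sum_j q i j * (p i * p j * (u i - u j) ^+ 2) / 2 =
    (\sum_i \sum_j q i j * (p i * p j * u i ^+ 2) +
     \sum_i \sum_j q i j * (p i * p j * u j ^+ 2)) / 2 -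
    \sum_i \sum_j q i j * (p i * u i) * (p j * u j).
  rewrite -big_split mulr_suml -sumrB; apply: eq_bigr => i _ /=.
  by rewrite -big_split mulr_suml -sumrB; apply: eq_bigr => j _ /=; field.
have half (x : R) : (x + x) / 2 = x by field.
rewrite -sym half.
rewrite -sumrB -big_split; apply: eq_bigr => i _ /=.
have -> : \sum_j q i j * (p i - p j) = p i * \sum_j q i j - \sum_j q i j * p j.
  by rewrite mulr_sumr -sumrB; apply: eq_bigr => j _; ring.
have -> : \sum_j q i j * (p i * p j * u i ^+ 2) =
    p i * u i ^+ 2 * \sum_j q i j * p j.
  by rewrite mulr_sumr; apply: eq_bigr => j _; ring.
by rewrite exprMn; ring.
Qed.

Lemma graph_formE M D (q : 'I_M -> 'I_M -> R) (u : 'I_M -> R) :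
  (forall i j, q i j = q j i) ->
  graph_form D q u = \sum_i \sum_j q i j * (u i - u j) ^+ 2 / 2 +
                     \sum_i u i ^+ 2 * killing D q i.
Proof.
move=> qC; transitivity (graph_form D q (fun i => 1 * u i)).
  by apply: eq_bigr => i _; rewrite mul1r; under [in RHS]eq_bigr do rewrite mul1r.
rewrite (graph_form_multiplier _ (fun=> 1) _ qC); congr (_ + _).
  by apply: eq_bigr => i _; apply: eq_bigr => j _; rewrite !mul1r.
apply: eq_bigr => i _; rewrite big1 ?mulr0 ?add0r ?expr1n ?mulr1// => j _.
by rewrite subrr mulr0.
Qed.

Lemma graph_form_ge0 M D (q : 'I_M -> 'I_M -> R) (u : 'I_M -> R) :
  (forall i j, q i j = q j i) -> (forall i j, 0 <= q i j) ->
  (forall i, 0 <= killing D q i) -> 0 <= graph_form D q u.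
Proof.
move=> qC q0 k0; rewrite graph_formE// addr_ge0//.
  by apply: sumr_ge0 => i _; apply: sumr_ge0 => j _; rewrite divr_ge0// mulr_ge0// sqr_ge0.
by apply: sumr_ge0 => i _; rewrite mulr_ge0// sqr_ge0.
Qed.

(** In [graph_form_multiplier] the jump part gains a factor at most B^2, and
    each of the drift and the killing part is at most B^2 times the killing
    part. *)
Lemma graph_form_multiplier_le M D (q : 'I_M -> 'I_M -> R) (p u : 'I_M -> R) (B : R) :
  (forall i j, q i j = q j i) -> (forall i j, 0 <= q i j) ->
  (forall i, 0 <= killing D q i) -> (forall i, 0 <= p i <= B) ->
  (forall i, p i * (\sum_j q i j * (p i - p j)) <= B ^+ 2 * killing D q i) ->
  graph_form D q (fun i => p i * u i) <= 2 * B ^+ 2 * graph_form D q u.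
Proof.
move=> qC q0 k0 pB drift; rewrite graph_form_multiplier// graph_formE// mulrDr.
have pp i j : 0 <= p i * p j <= B ^+ 2.
  have /andP[a b] := pB i; have /andP[c d] := pB j.
  by rewrite mulr_ge0//= expr2 ler_pM.
apply: lerD.
  rewrite mulr_sumr; apply: ler_sum => i _; rewrite mulr_sumr; apply: ler_sum => j _.
  have /andP[a b] := pp i j.
  have h0 : 0 <= q i j * (u i - u j) ^+ 2 / 2 by rewrite divr_ge0// mulr_ge0// sqr_ge0.
  have -> : q i j * (p i * p j * (u i - u j) ^+ 2) / 2 =
     p i * p j * (q i j * (u i - u j) ^+ 2 / 2) by ring.
  apply: le_trans (ler_wpM2r h0 b) _; rewrite ler_wpM2r// ler_peMl ?sqr_ge0//.
  by rewrite ler1n.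
rewrite mulr_sumr; apply: ler_sum => i _; rewrite [leRHS]mulrCA ler_wpM2l ?sqr_ge0//.
have := drift i; have : killing D q i * p i ^+ 2 <= killing D q i * B ^+ 2.
  by rewrite ler_wpM2l// expr2; have /andP[] := pp i i.
lra.
Qed.

End DirichletForm.

(** * The Toeplitz form as a Dirichlet form *)

Section ToeplitzGraph.
Variable R : realType.

(** Groups the terms by their distance l to [i], so that the jumps to i - l and
    to i + l appear together; the booleans record which of them stay in the
    grid. *)
Lemma sum_dist_split (Q : nat -> R) (f : nat -> R) M L (i : 'I_M) : (M <= L)%N ->
  Q 0%N = 0 ->
  \sum_(j < M) Q ((i - j) + (j - i))%N * f j =
  \sum_(l < L) Q l * ((l <= i)%N%:R * f (i - l)%N + (i + l < M)%N%:R * f (i + l)%N).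
Proof.
move=> ML Q0; have iM := ltn_ord i.
have -> : \sum_(j < M) Q ((i - j) + (j - i))%N * f j =
   \sum_(j < i) Q (i - j)%N * f j + \sum_(l < M - i) Q l * f (i + l)%N.
  rewrite -(big_mkord xpredT (fun j => Q ((i - j) + (j - i))%N * f j)).
  rewrite (@big_cat_nat _ _ _ i) //=; last exact: ltnW.
  rewrite big_mkord; congr (_ + _).
    apply: eq_bigr => j _; congr (Q _ * _).
    by have := ltn_ord j; lia.
  rewrite -{1}(add0n (i : nat)) big_addn big_mkord; apply: eq_bigr => l _.
  by congr (Q _ * f _); lia.
have -> : \sum_(j < i) Q (i - j)%N * f j = \sum_(l < i.+1) Q l * f (i - l)%N.
  rewrite big_ord_recl Q0 mul0r add0r (reindex_inj rev_ord_inj) /=.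
  apply: eq_bigr => j _; have ji := ltn_ord j.
  by rewrite /bump ?leq0n ?add1n; congr (Q _ * f _); lia.
rewrite (big_ord_widen L (fun l => Q l * f (i - l)%N)); last by apply: leq_trans ML.
rewrite (big_ord_widen L (fun l => Q l * f (i + l)%N)); last first.
  by apply: leq_trans ML; rewrite leq_subr.
rewrite big_mkcond [X in _ + X]big_mkcond -big_split; apply: eq_bigr => l _ /=.
rewrite ltnS ltn_subRL; case: (_ <= _)%N; case: (_ < _)%N; rewrite ?mul1r ?mul0r; ring.
Qed.

Variables (gamma : R) (M : nat).
Hypothesis g12 : 1 <= gamma <= 2.

(** The entry of the symmetric part of G at distance l > 0 from the diagonal;
    w_0 joins w_2 at distance 1. *)
Definition jump_rate (l : nat) : R :=
  if l is l'.+1 then (w_coef gamma l.+1 + (l' == 0%N)%:R * w_coef gamma 0) / 2 else 0.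

Definition jump (i j : 'I_M) : R := jump_rate ((i - j) + (j - i))%N.

Lemma jump_rate_ge0 l : 0 <= jump_rate l.
Proof.
case: l => [//|[|l]]; rewrite /jump_rate divr_ge0//.
  by rewrite mul1r addrC w_coef02_ge0.
by rewrite mul0r addr0 w_coef_ge0.
Qed.

Lemma jumpC i j : jump i j = jump j i.
Proof. by rewrite /jump addnC. Qed.

(** Twice the sum of the rates is a partial sum of w without its term w_1, and
    the partial sums of w are nonpositive. *)
Lemma sum_jump_rate n : 2 * (\sum_(l < n.+2) jump_rate l) <= - w_coef gamma 1.
Proof.
rewrite -subr_ge0 -oppr_le0 (le_trans _ (sum_w_coef_le0 n g12))//.
rewrite 2![in leRHS]big_ord_recl [in leLHS]big_ord_recl mulrDr mulr_sumr.
have -> : \sum_(i < n.+1) 2 * jump_rate (lift ord0 i) =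
  w_coef gamma 0 + \sum_(i < n.+1) w_coef gamma (lift ord0 (lift ord0 i)).
  rewrite big_ord_recl [in RHS]big_ord_recl addrA; congr (_ + _).
    by rewrite /jump_rate /=; field.
  apply: eq_bigr => i _; rewrite !lift0 /jump_rate mul0r addr0.
  by rewrite mulrC divfK.
rewrite [X in 2 * X](_ : _ = 0)// mulr0 -[nat_of_ord (lift ord0 ord0)]/1%N.
by move: (\sum_(i < _) _) => S; lra.
Qed.

Lemma toeplitz_form_graph (u : 'I_M -> R) :
  - toeplitz_form (w_coef gamma) u u = graph_form (- w_coef gamma 1) jump u.
Proof.
pose c (a b : 'I_M) := if (b <= a.+1)%N then w_coef gamma (a.+1 - b)%N else 0.
have sym : toeplitz_form (w_coef gamma) u u =
   \sum_a \sum_b (c a b + c b a) / 2 * (u a * u b).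
  have e : toeplitz_form (w_coef gamma) u u = \sum_a \sum_b c a b * (u a * u b).
    by apply: eq_bigr => a _; apply: eq_bigr => b _; rewrite /c; ring.
  have e' : toeplitz_form (w_coef gamma) u u = \sum_a \sum_b c b a * (u a * u b).
    rewrite e exchange_big; apply: eq_bigr => a _; apply: eq_bigr => b _.
    by rewrite (mulrC (u a)).
  transitivity ((toeplitz_form (w_coef gamma) u u + toeplitz_form (w_coef gamma) u u) / 2).
    by field.
  rewrite {1}e e' -big_split mulr_suml; apply: eq_bigr => a _ /=.
  by rewrite -big_split mulr_suml; apply: eq_bigr => b _ /=; ring.
rewrite sym /graph_form -sumrN; apply: eq_bigr => a _.
have -> : - w_coef gamma 1 * u a ^+ 2 =
   \sum_b (a == b)%:R * (- w_coef gamma 1) * (u a * u b).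
  rewrite (bigD1 a)//= eqxx big1 ?addr0 => [|b ba].
    by rewrite -[true%:R]/(1 : R) mul1r expr2.
  by rewrite eq_sym (negbTE ba) !mul0r.
rewrite -sumrN -sumrB; apply: eq_bigr => b _.
have wlt (x y : 'I_M) : (x < y)%N -> (c x y + c y x) / 2 = jump x y.
  move=> xy; rewrite /c /jump.
  have -> : (x - y + (y - x) = (y - x).-1.+1)%N by lia.
  rewrite /jump_rate; have -> : (x <= y.+1)%N by lia.
  have -> : (y.+1 - x = (y - x).-1.+2)%N by lia.
  rewrite addrC; congr ((_ + _) / 2).
  have -> : (y <= x.+1)%N = ((y - x).-1 == 0)%N by apply/idP/idP; lia.
  case: eqP => [e|_]; last by rewrite mul0r.
  by rewrite mul1r; congr w_coef; lia.
case: (ltngtP a b) => [ab|ba|/val_inj <-].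
- by rewrite -val_eqE (ltn_eqF ab) !mul0r sub0r wlt// mulrA.
- by rewrite -val_eqE (gtn_eqF ba) !mul0r sub0r addrC wlt// jumpC mulrA.
- rewrite eqxx /c leqnSn subSnn /jump subnn -[true%:R]/(1 : R) mul1r.
  rewrite -[jump_rate (0 + 0)]/0 !mul0r subr0.
  by move: (w_coef gamma 1) => w; field.
Qed.

Lemma killing_jump (i : 'I_M) : killing (- w_coef gamma 1) jump i =
  - w_coef gamma 1 - \sum_(l < M.+2) jump_rate l * ((l <= i)%N%:R + (i + l < M)%N%:R).
Proof.
rewrite /killing /jump; congr (_ - _).
transitivity (\sum_(j < M) jump_rate (i - j + (j - i)) * (fun=> 1) (nat_of_ord j)).
  by apply: eq_bigr => j _; rewrite mulr1.
rewrite (sum_dist_split (fun=> 1) i (leq_trans (leqnSn M) (leqnSn _))) //.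
by apply: eq_bigr => l _; rewrite !mulr1.
Qed.

(** For each l, the jumps of length l that leave the grid count in the killing
    term, since the total rate over both directions is at most - w_1. *)
Lemma killing_jump_ge (i : 'I_M) :
  \sum_(l < M.+2) jump_rate l * (2 - (l <= i)%N%:R - (i + l < M)%N%:R) <=
  killing (- w_coef gamma 1) jump i.
Proof.
rewrite killing_jump lerBrDr -big_split /=.
apply: le_trans (sum_jump_rate M); rewrite mulr_sumr; apply: ler_sum => l _.
by rewrite le_eqVlt; apply/orP; left; apply/eqP; ring.
Qed.

Lemma killing_jump_ge0 i : 0 <= killing (- w_coef gamma 1) jump i.
Proof.
apply: le_trans (killing_jump_ge i); apply: sumr_ge0 => l _.
rewrite mulr_ge0 ?jump_rate_ge0//.
by case: (_ <= _)%N; case: (_ < _)%N => /=; lra.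
Qed.

Lemma toeplitz_form_ge0 (u : 'I_M -> R) : 0 <= - toeplitz_form (w_coef gamma) u u.
Proof.
rewrite toeplitz_form_graph graph_form_ge0//; first exact: jumpC.
  by move=> i j; exact: jump_rate_ge0.
exact: killing_jump_ge0.
Qed.

(** Restricted to neighbours inside the grid: the sections are convex on an
    open interval, whose ends are the excluded boundary nodes. *)
Definition midpoint_convex (p : nat -> R) : Prop :=
  forall i l, (l <= i)%N -> (i + l < M)%N -> 2 * p i <= p (i - l)%N + p (i + l)%N.

(** For each length l: if both i - l and i + l are in the grid, convexity makes
    the drift nonpositive; if only one is, the drift is at most B^2 times the
    rate, which the killing term contains because the mirror jump leaves the
    grid. *)
Lemma toeplitz_form_multiplier (p : nat -> R) (B : R) (u : 'I_M -> R) :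
  (forall i, (i < M)%N -> 0 <= p i <= B) -> midpoint_convex p ->
  - toeplitz_form (w_coef gamma) (fun i => p i * u i) (fun i => p i * u i) <=
  2 * B ^+ 2 * - toeplitz_form (w_coef gamma) u u.
Proof.
move=> pB pconv; rewrite !toeplitz_form_graph.
apply: (@graph_form_multiplier_le _ M _ jump (fun i : 'I_M => p i)) => //.
- exact: jumpC.
- by move=> i j; exact: jump_rate_ge0.
- exact: killing_jump_ge0.
- by move=> i; exact: pB.
move=> i; apply: (@le_trans _ _ (B ^+ 2 *
   \sum_(l < M.+2) jump_rate l * (2 - (l <= i)%N%:R - (i + l < M)%N%:R))); last first.
  by rewrite ler_wpM2l ?sqr_ge0// killing_jump_ge.
rewrite (sum_dist_split (fun j => p i - p j) i (leq_trans (leqnSn M) (leqnSn _))) //.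
rewrite !mulr_sumr; apply: ler_sum => l _.
rewrite mulrCA [leRHS]mulrCA ler_wpM2l ?jump_rate_ge0//.
have /andP[pi0 piB] := pB i (ltn_ord i).
have one_side j : (j < M)%N -> p i * (p i - p j) <= B ^+ 2.
  move=> jM; have /andP[pj0 _] := pB j jM.
  apply: (@le_trans _ _ (p i * p i)); first by rewrite ler_wpM2l// lerBlDr lerDl.
  by rewrite expr2 ler_pM.
case: (leqP l i) => li; case: (ltnP (i + l) M) => il;
  rewrite ?mul1r ?mul0r ?addr0 ?add0r ?subr0.
- have -> : 2 - 1 - 1 = 0 :> R by ring.
  by rewrite mulr0 mulr_ge0_le0//; have := pconv i l li il; lra.
- have -> : 2 - 1 = 1 :> R by ring.
  by rewrite mulr1 one_side// (leq_ltn_trans (leq_subr _ _)).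
- have -> : 2 - 1 = 1 :> R by ring.
  by rewrite mulr1 one_side.
- by rewrite mulr0 mulr_ge0// sqr_ge0.
Qed.

End ToeplitzGraph.

(** * Weighted forms on one grid line *)

Section WeightedForm.
Variable R : realType.
Implicit Types (gamma L U B m lo hi : R) (M : nat).

Lemma toeplitz_formZl M w (c : R) (v u : 'I_M -> R) :
  toeplitz_form w (fun i => c * v i) u = c * toeplitz_form w v u.
Proof.
rewrite mulr_sumr; apply: eq_bigr => i _; rewrite mulr_sumr.
by apply: eq_bigr => j _; rewrite !mulrA.
Qed.

Lemma toeplitz_formZr M w (c : R) (v u : 'I_M -> R) :
  toeplitz_form w v (fun i => c * u i) = c * toeplitz_form w v u.
Proof.
rewrite mulr_sumr; apply: eq_bigr => i _; rewrite mulr_sumr.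
by apply: eq_bigr => j _; ring.
Qed.

(** The half-angle of the sector is s pi/2 = pi - gamma pi/2, so its cosine is
    the absolute value of cos (gamma pi/2). *)
Lemma varsigma_cos gamma : 1 < gamma < 2 ->
  varsigma gamma = cos ((2 - gamma) / 2 * pi) /\ 0 < varsigma gamma.
Proof.
move=> /andP[g1 g2]; have pi0 := pi_gt0 R.
have -> : varsigma gamma = `|cos ((2 - gamma) / 2 * pi)|.
  have -> : (2 - gamma) / 2 * pi = - (gamma / 2 * pi) + pi by field.
  by rewrite cosDpi cosN normrN.
have c0 : 0 < cos ((2 - gamma) / 2 * pi).
  apply: cos_gt0_pihalf; apply/andP; split; move: (pi : R) pi0 => x x0; nra.
by rewrite gtr0_norm.
Qed.

(** The sector property with v = c p u and 2 c^2 B^2 = 1, for which the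
    multiplier estimate gives F(v) <= F(u); the two signs of c give the absolute
    value. *)
Lemma toeplitz_cross_bound gamma M (p : nat -> R) B (u : 'I_M -> R) :
  1 < gamma < 2 -> (forall i, (i < M)%N -> 0 <= p i <= B) ->
  midpoint_convex M p -> 0 <= B ->
  `|toeplitz_form (w_coef gamma) (fun i => p i * u i) u| <=
    Num.sqrt 2 / varsigma gamma * B * - toeplitz_form (w_coef gamma) u u.
Proof.
move=> g12 pB pconv B0; have [vE v0] := varsigma_cos g12.
have g12' : 1 <= gamma <= 2 by have /andP[a b] := g12; apply/andP; split; lra.
have F0 := toeplitz_form_ge0 g12' u.
have FB := toeplitz_form_multiplier g12' u pB pconv.
move: B0; rewrite le_eqVlt => /orP[/eqP B0|B0].
  have -> : toeplitz_form (w_coef gamma) (fun i => p i * u i) u = 0.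
    rewrite /toeplitz_form big1// => i _; rewrite big1// => j _.
    have /andP[pi_ge0 pi_leB] := pB i (ltn_ord i).
    have -> : p i = 0 by apply/eqP; rewrite eq_le pi_ge0 andbT B0.
    by rewrite !mul0r.
  by rewrite -B0 normr0 mulr0 mul0r.
have s01 : 0 < 2 - gamma <= 1 by have /andP[a b] := g12; apply/andP; split; lra.
have sec := toeplitz_sector s01.
have gE : 2 - (2 - gamma) = gamma by ring.
rewrite gE -vE in sec.
have q0 : 0 < Num.sqrt 2 :> R by rewrite sqrtr_gt0.
have q2 : Num.sqrt 2 ^+ 2 = 2 :> R by rewrite sqr_sqrtr.
set X := toeplitz_form _ (fun i => p i * u i) u.
set F := - toeplitz_form _ u u in F0 FB *.
have key c : c ^+ 2 * (2 * B ^+ 2) = 1 -> - (varsigma gamma * c * X) <= F.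
  move=> c2; have := sec M (fun i => c * (p i * u i)) u.
  rewrite toeplitz_formZr !toeplitz_formZl -/X -/F.
  have := ler_wpM2l (sqr_ge0 c) FB; rewrite [leRHS]mulrA c2 mul1r.
  by move: (toeplitz_form _ _ _) => Y; lra.
have qn : Num.sqrt 2 != 0 :> R by exact: lt0r_neq0.
have Bn := lt0r_neq0 B0.
have vn := lt0r_neq0 v0.
have c2 : (Num.sqrt 2 * B)^-1 ^+ 2 * (2 * B ^+ 2) = 1.
  by rewrite exprVn exprMn q2 mulVf// mulf_neq0// expf_neq0.
have r0 : 0 < varsigma gamma * (Num.sqrt 2 * B)^-1.
  by rewrite mulr_gt0// invr_gt0 mulr_gt0.
rewrite -(ler_pM2l r0) -[X in X * `|_|](gtr0_norm r0) -normrM.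
have -> : varsigma gamma / (Num.sqrt 2 * B) *
  (Num.sqrt 2 / varsigma gamma * B * F) = F.
  by field; apply/and3P.
rewrite ler_norml; apply/andP; split.
  by rewrite lerNl; exact: key.
have := key (- (Num.sqrt 2 * B)^-1); rewrite sqrrN => /(_ c2).
by rewrite mulrN mulNr opprK.
Qed.

(** A convex weight is [lo] plus a multiplier with values in [0, hi - lo], a
    concave one is [hi] minus such a multiplier. *)
Lemma weighted_form_bound gamma M (f : nat -> R) m lo hi (u : 'I_M -> R) :
  1 < gamma < 2 -> lo <= hi ->
  (forall i, (i < M)%N -> lo <= f i <= hi) ->
  (midpoint_convex M f /\ m = lo) \/
  (midpoint_convex M (fun i => - f i) /\ m = hi) ->
  `|- toeplitz_form (w_coef gamma) (fun i => f i * u i) u -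
    m * - toeplitz_form (w_coef gamma) u u| <=
    Num.sqrt 2 / varsigma gamma * (hi - lo) * - toeplitz_form (w_coef gamma) u u.
Proof.
move=> g12 lohi fB conv.
have split_form (p : nat -> R) c e :
    (forall i, f i = c + e * p i) ->
    toeplitz_form (w_coef gamma) (fun i : 'I_M => f i * u i) u =
    c * toeplitz_form (w_coef gamma) u u +
    e * toeplitz_form (w_coef gamma) (fun i : 'I_M => p i * u i) u.
  move=> fE; rewrite -toeplitz_formZl -[in X in _ + X]toeplitz_formZl -big_split.
  apply: eq_bigr => i _; rewrite -big_split; apply: eq_bigr => j _ /=.
  by rewrite fE; ring.
have hl : 0 <= hi - lo by rewrite subr_ge0.
case: conv => -[fconv ->].
- rewrite (split_form (fun i => f i - lo) lo 1) => [|i]; last by ring.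
  rewrite (_ : _ - _ = - toeplitz_form (w_coef gamma)
     (fun i : 'I_M => (f i - lo) * u i) u) ?normrN; last by ring.
  apply: (@toeplitz_cross_bound gamma M (fun i => f i - lo)) => //.
    by move=> i /fB /andP[a b]; apply/andP; split; lra.
  by move=> i l li il; have := fconv i l li il; lra.
- rewrite (split_form (fun i => hi - f i) hi (-1)) => [|i]; last by ring.
  rewrite (_ : _ - _ = toeplitz_form (w_coef gamma)
     (fun i : 'I_M => (hi - f i) * u i) u); last by ring.
  apply: (@toeplitz_cross_bound gamma M (fun i => hi - f i)) => //.
    by move=> i /fB /andP[a b]; apply/andP; split; lra.
  by move=> i l li il; have := fconv i l li il; lra.
Qed.

Lemma node_in_itv L U M k : L < U -> (k < M)%N -> node L U M k.+1 \in `]L, U[.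
Proof.
move=> LU kM; rewrite in_itv /= /node /mesh; apply/andP; split.
  by rewrite ltrDl mulr_gt0// divr_gt0// subr_gt0.
rewrite -ltrBrDl mulrCA gtr_pMr ?subr_gt0// ltr_pdivrMr// mul1r ltr_nat ltnS //.
Qed.

Lemma convex_on_nodes L U M (f : R -> R) : L < U -> convex_on L U f ->
  midpoint_convex M (fun i => f (node L U M i.+1)).
Proof.
move=> LU cf i l li il.
have xin : node L U M (i - l).+1 \in (`]L, U[%classic : set R).
  rewrite inE /= node_in_itv// (leq_ltn_trans _ il)//.
  by rewrite (leq_trans (leq_subr _ _))// leq_addr.
have yin : node L U M (i + l).+1 \in (`]L, U[%classic : set R).
  by rewrite inE /= node_in_itv.
have h01 : Itv.spec (@Itv.num_sem R) (Itv.Real `[0%Z, 1%Z]) (2^-1 : R).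
  by apply/and3P; split; rewrite ?num_real// /= bnd_simp; lra.
pose t : {i01 R} := Itv.mk h01.
have := cf t _ _ xin yin; rewrite convRE [X in f X <= _]convRE /= .
have -> : unstable.onem (2^-1) = 2^-1 :> R by rewrite /unstable.onem; field.
rewrite -!mulrDr.
have -> : 2^-1 * (node L U M (i - l).+1 + node L U M (i + l).+1) = node L U M i.+1.
  have e : (i - l).+1%:R + (i + l).+1%:R = 2 * i.+1%:R :> R.
    by rewrite -natrD -natrM; congr (_%:R); lia.
  rewrite /node; transitivity (L + 2^-1 * ((i - l).+1%:R + (i + l).+1%:R) * mesh L U M).
    by field.
  by rewrite e [2^-1 * (2 * _)]mulrA mulVf ?mul1r.
lra.
Qed.

Lemma inf_sup_on_bounds L U (f : R -> R) lo hi : L < U ->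
  (forall x, x \in `]L, U[ -> lo <= f x <= hi) ->
  [/\ forall x, x \in `]L, U[ -> inf_on L U f <= f x <= sup_on L U f,
      lo <= inf_on L U f & sup_on L U f <= hi].
Proof.
move=> LU fb.
have ne : (f @` `]L, U[) !=set0.
  exists (f ((L + U) / 2)); exists ((L + U) / 2) => //=.
  by rewrite in_itv /=; apply/andP; split; lra.
have lb : lbound (f @` `]L, U[) lo by move=> _ [x xin <-]; have /andP[] := fb x xin.
have ub : ubound (f @` `]L, U[) hi by move=> _ [x xin <-]; have /andP[] := fb x xin.
split; last 2 first.
- exact: lb_le_inf.
- exact: ge_sup.
move=> x xin; apply/andP; split.
  by apply: ge_inf; [exists lo|exists x].
by apply: ub_le_sup; [exists hi|exists x].
Qed.

Lemma Mtilde_bounds L U (f : R -> R) m lo hi : L < U ->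
  (forall x, x \in `]L, U[ -> lo <= f x <= hi) -> is_Mtilde L U f m ->
  lo <= m <= hi.
Proof.
move=> LU fb; have [h1 h2 h3] := inf_sup_on_bounds LU fb.
have mid : (L + U) / 2 \in `]L, U[ by rewrite in_itv /=; apply/andP; split; lra.
by have /andP[a b] := h1 _ mid; case=> -[_ ->]; apply/andP; split; lra.
Qed.

Lemma section_form_bound gamma L U M (f : R -> R) m lo hi (u : 'I_M -> R) :
  1 < gamma < 2 -> L < U ->
  (forall x, x \in `]L, U[ -> lo <= f x <= hi) -> is_Mtilde L U f m ->
  `|- toeplitz_form (w_coef gamma) (fun i => f (node L U M i.+1) * u i) u -
    m * - toeplitz_form (w_coef gamma) u u| <=
    Num.sqrt 2 / varsigma gamma * (sup_on L U f - inf_on L U f) *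
    - toeplitz_form (w_coef gamma) u u.
Proof.
move=> g12 LU fb mt; have [h1 h2 h3] := inf_sup_on_bounds LU fb.
have mid : (L + U) / 2 \in `]L, U[ by rewrite in_itv /=; apply/andP; split; lra.
apply: (@weighted_form_bound gamma M (fun i => f (node L U M i.+1))) => //.
- by have /andP[] := h1 _ mid; exact: le_trans.
- by move=> i iM; apply: h1; exact: node_in_itv.
case: mt => -[cf ->]; [left|right]; split => //; first exact: convex_on_nodes.
exact: (@convex_on_nodes L U M (fun x => - f x)).
Qed.

End WeightedForm.

(** * Singular values from two-sided quadratic bounds *)

Section Quadratic.
Variables (R : realType) (n : nat).
Implicit Types (x y u : 'cV[R]_n) (C K : 'M[R]_n).

Definition dot x y : R := \sum_i x i 0 * y i 0.

Lemma dotC x y : dot x y = dot y x.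
Proof. by apply: eq_bigr => i _; rewrite mulrC. Qed.

Lemma dotDr x y z : dot x (y + z) = dot x y + dot x z.
Proof. by rewrite -big_split; apply: eq_bigr => i _; rewrite mxE mulrDr. Qed.

Lemma dotDl x y z : dot (x + y) z = dot x z + dot y z.
Proof. by rewrite dotC dotDr !(dotC z). Qed.

Lemma dotZr (c : R) x y : dot x (c *: y) = c * dot x y.
Proof. by rewrite mulr_sumr; apply: eq_bigr => i _; rewrite mxE mulrCA. Qed.

Lemma dotZl (c : R) x y : dot (c *: x) y = c * dot x y.
Proof. by rewrite dotC dotZr dotC. Qed.

Lemma dot_ge0 x : 0 <= dot x x.
Proof. by apply: sumr_ge0 => i _; rewrite -expr2 sqr_ge0. Qed.

Lemma dot_eq0 x : dot x x = 0 -> x = 0.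
Proof.
move=> /eqP; rewrite psumr_eq0 => [/allP h|i _]; last by rewrite -expr2 sqr_ge0.
apply/matrixP => i j; rewrite ord1 mxE; apply/eqP.
by have := h i (mem_index_enum _); rewrite mulf_eq0 orbb.
Qed.

Lemma dot_mulmx C x y : dot x (C *m y) = dot (C^T *m x) y.
Proof.
transitivity (\sum_i \sum_j x i 0 * C i j * y j 0).
  by apply: eq_bigr => i _; rewrite mxE mulr_sumr; apply: eq_bigr => j _; rewrite mulrA.
rewrite exchange_big; apply: eq_bigr => j _ /=; rewrite mxE mulr_suml.
by apply: eq_bigr => i _; rewrite mxE (mulrC (C i j)).
Qed.

Lemma l2norm_sqr x : l2norm x ^+ 2 = dot x x.
Proof.
rewrite sqr_sqrtr; first by apply: eq_bigr => i _; rewrite expr2.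
by apply: sumr_ge0 => i _; rewrite sqr_ge0.
Qed.

Lemma l2norm_ge0 x : 0 <= l2norm x. Proof. exact: sqrtr_ge0. Qed.

(** Injectivity on columns is triviality of the kernel of the transpose, which
    acts on rows. *)
Lemma injective_unitmx C : (forall x, C *m x = 0 -> x = 0) -> C \in unitmx.
Proof.
move=> inj; rewrite -unitmx_tr -row_free_unit -kermx_eq0; apply/eqP/row_matrixP => i.
rewrite row0; apply: trmx_inj; rewrite trmx0; apply: inj.
have /sub_kermxP e := row_sub i (kermx C^T).
by rewrite -[RHS]trmx0 -e trmx_mul trmxK.
Qed.

Section TwoSided.
Variables (C : 'M[R]_n) (lo hi : R).
Hypothesis lo_gt0 : 0 < lo.
Hypothesis Cb : forall x, lo * dot x x <= dot (C *m x) (C *m x) <= hi * dot x x.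

Lemma two_sided_unitmx : C \in unitmx.
Proof.
apply: injective_unitmx => x Cx0; apply: dot_eq0; apply/eqP.
rewrite eq_le dot_ge0 andbT -(pmulr_rle0 _ lo_gt0).
have /andP[h _] := Cb x; apply: le_trans h _.
by rewrite Cx0 /dot big1// => i _; rewrite mxE mul0r.
Qed.

(** If s^2 is an eigenvalue of C^T C with eigenvector x, then
    |C x|^2 = s^2 |x|^2. *)
Lemma two_sided_singular_values : sq_singular_values C `<=` `[lo, hi].
Proof.
move=> _ [s [s0 /eigenvalueP[v vC v0]] <-] /=.
pose x := v^T; have CCx : C^T *m (C *m x) = s ^+ 2 *: x.
  by apply: trmx_inj; rewrite linearZ /= trmxK mulmxA !trmx_mul !trmxK mulmxA -vC mulmxA.
have e : dot (C *m x) (C *m x) = s ^+ 2 * dot x x.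
  by rewrite dot_mulmx CCx dotZl.
have x0 : 0 < dot x x.
  rewrite lt_neqAle dot_ge0 andbT eq_sym; apply: contra v0 => /eqP /dot_eq0 xe.
  by rewrite -[v]trmxK -/x xe trmx0.
by have := Cb x; rewrite e in_itv /= !ler_pM2r.
Qed.

Lemma mxnorm2_le D k : 0 <= k ->
  (forall x, dot (D *m x) (D *m x) <= k ^+ 2 * dot x x) -> 0 <= mxnorm2 D <= k.
Proof.
move=> k0 Db; rewrite /mxnorm2; set S := (X in sup X).
have Sub : ubound S k.
  move=> _ [x /= x1 <-]; rewrite -ler_sqr ?nnegrE ?l2norm_ge0//.
  by rewrite l2norm_sqr (le_trans (Db x))// -l2norm_sqr x1 expr1n mulr1.
have [ne|/set0P/negP/negPn/eqP ->] := pselect (S !=set0); last by rewrite sup0 lexx.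
apply/andP; split; last exact: ge_sup.
have [y Sy] := ne; apply: le_trans (ub_le_sup _ Sy); last by exists k.
by case: Sy => x _ <-; exact: l2norm_ge0.
Qed.

Lemma two_sided_cond2 : 0 <= hi -> (cond2 C <= (Num.sqrt (hi / lo))%:E)%E.
Proof.
move=> hi0; rewrite /cond2 two_sided_unitmx lee_fin.
have /andP[a0 a1] : 0 <= mxnorm2 C <= Num.sqrt hi.
  apply: mxnorm2_le => [|x]; first exact: sqrtr_ge0.
  by rewrite sqr_sqrtr//; have /andP[] := Cb x.
have /andP[b0 b1] : 0 <= mxnorm2 (invmx C) <= Num.sqrt lo^-1.
  apply: mxnorm2_le => [|x]; first exact: sqrtr_ge0.
  rewrite sqr_sqrtr ?invr_ge0 ?(ltW lo_gt0)// -ler_pdivrMl ?invr_gt0// invrK.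
  have /andP[h _] := Cb (invmx C *m x); apply: le_trans h _.
  by rewrite mulKVmx// two_sided_unitmx.
by rewrite sqrtrM// ler_pM.
Qed.

End TwoSided.

(** Termwise comparison of
      |P u|^2 = |u|^2 + 2 m <u, K u> + m^2 |K u|^2 and
      |A u|^2 = |u|^2 + 2 <u, S K u> + |S K u|^2.
    Since ac <= m <= ah, the ratios of the three pairs of terms are at least 1,
    c1 / ah and ac^2 / ah^2, and at most 1, c2 / ac and ah^2 / ac^2; the first
    is absorbed because ac <= ah. *)
Lemma diag_dominated_bounds (S : 'rV[R]_n) K (ac ah m c1 c2 lo hi : R) :
  0 < ac -> (forall k, ac <= S 0 k <= ah) -> ac <= m <= ah ->
  (forall u, 0 <= dot u (K *m u)) ->
  (forall u, c1 * dot u (K *m u) <= dot u (diag_mx S *m (K *m u)) <=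
             c2 * dot u (K *m u)) ->
  0 < lo -> lo <= c1 / ah -> lo <= ac ^+ 2 / ah ^+ 2 ->
  c2 / ac <= hi -> ah ^+ 2 / ac ^+ 2 <= hi ->
  1%:M + m *: K \in unitmx /\
  forall x, lo * dot x x <=
    dot ((1%:M + diag_mx S *m K) *m invmx (1%:M + m *: K) *m x)
        ((1%:M + diag_mx S *m K) *m invmx (1%:M + m *: K) *m x) <= hi * dot x x.
Proof.
move=> ac0 Sb /andP[m1 m2] K0 SK lo0 lo1 lo2 hi1 hi2.
have ah0 : 0 < ah by lra.
have m0 : 0 < m by lra.
have P_sqr u : dot ((1%:M + m *: K) *m u) ((1%:M + m *: K) *m u) =
   dot u u + 2 * m * dot u (K *m u) + m ^+ 2 * dot (K *m u) (K *m u).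
  rewrite mulmxDl mul1mx -scalemxAl !dotDr !dotDl !dotZr !dotZl (dotC (K *m u) u).
  by ring.
have A_sqr u : dot ((1%:M + diag_mx S *m K) *m u) ((1%:M + diag_mx S *m K) *m u) =
   dot u u + 2 * dot u (diag_mx S *m (K *m u)) +
   dot (diag_mx S *m (K *m u)) (diag_mx S *m (K *m u)).
  rewrite mulmxDl mul1mx -mulmxA !dotDr !dotDl (dotC _ u); ring.
have S_sqr y : ac ^+ 2 * dot y y <= dot (diag_mx S *m y) (diag_mx S *m y) <=
    ah ^+ 2 * dot y y.
  have -> : dot (diag_mx S *m y) (diag_mx S *m y) =
      \sum_k S 0 k ^+ 2 * (y k 0 * y k 0).
    by apply: eq_bigr => k _; rewrite mul_diag_mx mxE; ring.
  rewrite !mulr_sumr; apply/andP; split; apply: ler_sum => k _;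
    rewrite ler_wpM2r -?expr2 ?sqr_ge0//; have /andP[h1 h2] := Sb k;
    rewrite ler_pXn2r ?nnegrE//; lra.
have Punit : 1%:M + m *: K \in unitmx.
  apply: injective_unitmx => u Pu0; apply: dot_eq0; apply/eqP.
  have := P_sqr u; rewrite Pu0 {1}/dot big1; last by move=> i _; rewrite mxE mul0r.
  have := dot_ge0 u; have := mulr_ge0 (ltW m0) (K0 u).
  have := mulr_ge0 (sqr_ge0 m) (dot_ge0 (K *m u)).
  by move=> *; rewrite eq_le; apply/andP; split; lra.
split=> // x.
pose u := invmx (1%:M + m *: K) *m x.
have xE : x = (1%:M + m *: K) *m u by rewrite mulKVmx.
rewrite -[_ *m invmx _ *m x]mulmxA -/u.
rewrite {1 2 3 4}xE P_sqr A_sqr.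
have /andP[s1 s2] := S_sqr (K *m u); have /andP[k1 k2] := SK u.
have k0 := K0 u; have u0 := dot_ge0 u; have y0 := dot_ge0 (K *m u).
move: (dot u u) (dot u (K *m u)) (dot (K *m u) (K *m u))
  (dot u (diag_mx S *m (K *m u))) (dot (diag_mx S *m (K *m u)) _)
  s1 s2 k1 k2 k0 u0 y0 => U V Y V' Y' s1 s2 k1 k2 k0 u0 y0.
have ah2 : 0 < ah ^+ 2 by rewrite exprn_gt0.
have ac2 : 0 < ac ^+ 2 by rewrite exprn_gt0.
have le2 : ac ^+ 2 <= ah ^+ 2 by rewrite ler_pXn2r ?nnegrE//; lra.
rewrite ler_pdivlMr// in lo1; rewrite ler_pdivlMr// in lo2.
rewrite ler_pdivrMr// in hi1; rewrite ler_pdivrMr// in hi2.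
have lo_le1 : lo <= 1 by rewrite -(ler_pM2r ah2) mul1r (le_trans lo2).
have hi_ge1 : 1 <= hi by rewrite -(ler_pM2r ac2) mul1r (le_trans le2).
have hi0 : 0 < hi by lra.
have msq1 : m ^+ 2 <= ah ^+ 2 by rewrite ler_pXn2r ?nnegrE//; lra.
have msq2 : ac ^+ 2 <= m ^+ 2 by rewrite ler_pXn2r ?nnegrE//; lra.
have t1 : lo * U <= U by rewrite ler_piMl.
have t2 : lo * m * V <= V'.
  apply: le_trans k1; rewrite ler_wpM2r//; apply: le_trans lo1.
  by rewrite ler_wpM2l// ltW.
have t3 : lo * m ^+ 2 * Y <= Y'.
  apply: le_trans s1; rewrite ler_wpM2r//; apply: le_trans lo2.
  by rewrite ler_wpM2l// ltW.
have t1' : U <= hi * U by rewrite ler_peMl.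
have t2' : V' <= hi * m * V.
  apply: le_trans k2 _; rewrite ler_wpM2r//; apply: le_trans hi1 _.
  by rewrite ler_wpM2l// ltW.
have t3' : Y' <= hi * m ^+ 2 * Y.
  apply: le_trans s2 _; rewrite ler_wpM2r//; apply: le_trans hi2 _.
  by rewrite ler_wpM2l// ltW.
by apply/andP; split; lra.
Qed.

End Quadratic.

(** * Grid lines in the plane and the main theorem *)

Section TensorForms.
Variables (R : realType).
Implicit Types (gamma alpha beta L U : R).

Lemma sum_mxtens_index m n (F : 'I_(m * n) -> R) :
  \sum_k F k = \sum_(j < m) \sum_(i < n) F (mxtens_index (j, i)).
Proof.
rewrite pair_big /= (reindex (@mxtens_index m n)) /=.
  by apply: eq_bigr => -[].
exists (@mxtens_unindex m n) => k _; [exact: mxtens_indexK|exact: mxtens_unindexK].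
Qed.

(** In the numbering j * n + i the identity factor acts on j, so each j carries
    an independent Toeplitz form in i. *)
Lemma x_direction_form gamma m n (S : 'rV[R]_(m * n)) (u : 'cV[R]_(m * n)) :
  dot u (diag_mx S *m (tensmx 1%:M (G_mx gamma n) *m u)) =
  \sum_(j < m) toeplitz_form (w_coef gamma)
    (fun i => S 0 (mxtens_index (j, i)) * u (mxtens_index (j, i)) 0)
    (fun i => u (mxtens_index (j, i)) 0).
Proof.
rewrite /dot sum_mxtens_index; apply: eq_bigr => j _; apply: eq_bigr => i _.
rewrite mul_diag_mx !mxE sum_mxtens_index (bigD1 j) //= [X in _ + X]big1 ?addr0.
  rewrite !mulr_sumr; apply: eq_bigr => i' _.
  by rewrite tensmxE !mxE eqxx; case: ifP => _; rewrite /=; ring.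
move=> j' jj'; rewrite big1// => i' _.
by rewrite tensmxE [1%:M _ _]mxE eq_sym (negbTE jj') !mul0r.
Qed.

Lemma y_direction_form gamma m n (S : 'rV[R]_(m * n)) (u : 'cV[R]_(m * n)) :
  dot u (diag_mx S *m (tensmx (G_mx gamma m) 1%:M *m u)) =
  \sum_(i < n) toeplitz_form (w_coef gamma)
    (fun j => S 0 (mxtens_index (j, i)) * u (mxtens_index (j, i)) 0)
    (fun j => u (mxtens_index (j, i)) 0).
Proof.
rewrite /dot sum_mxtens_index exchange_big; apply: eq_bigr => i _.
apply: eq_bigr => j _; rewrite mul_diag_mx !mxE sum_mxtens_index exchange_big /=.
rewrite (bigD1 i) //= [X in _ + X]big1 ?addr0.
  rewrite !mulr_sumr; apply: eq_bigr => j' _.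
  by rewrite tensmxE !mxE eqxx; case: ifP => _; rewrite /=; ring.
move=> i' ii'; rewrite big1// => j' _.
by rewrite tensmxE [1%:M _ _]mxE eq_sym (negbTE ii') mulr0 mul0r.
Qed.

(** Each line z satisfies [section_form_bound] with its own constants; the
    infimum and supremum over z in [c_check] and [c_hat] then apply to all lines,
    as the forms F are nonnegative.  These extrema are meaningful because the
    expressions under them are bounded. *)
Lemma direction_bounds gamma L U L' U' ac ah (g : R -> R -> R) (Mt : R -> R)
  m n (u : 'I_m -> 'I_n -> R) :
  1 < gamma < 2 -> L < U -> L' < U' ->
  (forall z x, z \in `]L', U'[ -> x \in `]L, U[ -> ac <= g z x <= ah) ->
  (forall z, z \in `]L', U'[ -> is_Mtilde L U (g z) (Mt z)) ->
  let Mhat z := sup_on L U (g z) in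
  let Mcheck z := inf_on L U (g z) in
  let form := \sum_(j < m) - toeplitz_form (w_coef gamma) (u j) (u j) in
  let weighted := \sum_(j < m) - toeplitz_form (w_coef gamma)
    (fun i => g (node L' U' m j.+1) (node L U n i.+1) * u j i) (u j) in
  [/\ 0 <= form,
      c_check L' U' (varsigma gamma) Mt Mhat Mcheck * form <= weighted &
      weighted <= c_hat L' U' (varsigma gamma) Mt Mhat Mcheck * form].
Proof.
move=> g12 LU LU' gb hMt Mhat Mcheck form weighted.
have [_ v0] := varsigma_cos g12.
have g12' : 1 <= gamma <= 2 by have /andP[a b] := g12; apply/andP; split; lra.
pose w := Num.sqrt 2 / varsigma gamma.
have w0 : 0 <= w by rewrite divr_ge0 ?ltW// sqrtr_gt0.
have mid : (L + U) / 2 \in `]L, U[ by rewrite in_itv /=; apply/andP; split; lra.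
have osc z : z \in `]L', U'[ -> 0 <= Mhat z - Mcheck z <= ah - ac.
  move=> zin; have [h1 h2 h3] := inf_sup_on_bounds LU (fun x => gb z x zin).
  by have /andP[a b] := h1 _ mid; rewrite /Mhat /Mcheck; apply/andP; split; lra.
have Mtb z : z \in `]L', U'[ -> ac <= Mt z <= ah.
  by move=> zin; exact: (Mtilde_bounds LU (fun x => gb z x zin) (hMt z zin)).
have F0 j : 0 <= - toeplitz_form (w_coef gamma) (u j) (u j) by exact: toeplitz_form_ge0.
have [cc _ _] : [/\ forall z, z \in `]L', U'[ ->
    c_check L' U' (varsigma gamma) Mt Mhat Mcheck <= Mt z - w * (Mhat z - Mcheck z) <=
     sup_on L' U' (fun z => Mt z - w * (Mhat z - Mcheck z)),
    ac - w * (ah - ac) <= c_check L' U' (varsigma gamma) Mt Mhat Mcheck &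
    sup_on L' U' (fun z => Mt z - w * (Mhat z - Mcheck z)) <= ah].
  apply: (@inf_sup_on_bounds R L' U' (fun z => Mt z - w * (Mhat z - Mcheck z))) => // z zin.
  have /andP[a b] := osc z zin; have /andP[a' b'] := Mtb z zin.
  have := mulr_ge0 w0 a; have := ler_wpM2l w0 b; move=> h h'.
  by apply/andP; split; lra.
have [ch _ _] : [/\ forall z, z \in `]L', U'[ ->
    inf_on L' U' (fun z => Mt z + w * (Mhat z - Mcheck z)) <=
      Mt z + w * (Mhat z - Mcheck z) <=
      c_hat L' U' (varsigma gamma) Mt Mhat Mcheck,
    ac <= inf_on L' U' (fun z => Mt z + w * (Mhat z - Mcheck z)) &
    c_hat L' U' (varsigma gamma) Mt Mhat Mcheck <= ah + w * (ah - ac)].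
  apply: (@inf_sup_on_bounds R L' U' (fun z => Mt z + w * (Mhat z - Mcheck z))) => // z zin.
  have /andP[a b] := osc z zin; have /andP[a' b'] := Mtb z zin.
  have := mulr_ge0 w0 a; have := ler_wpM2l w0 b; move=> h h'.
  by apply/andP; split; lra.
have row_bound (j : 'I_m) := section_form_bound (u j) g12 LU
   (fun x => gb _ x (node_in_itv LU' (ltn_ord j))) (hMt _ (node_in_itv LU' (ltn_ord j))).
split; first by apply: sumr_ge0 => j _.
- rewrite mulr_sumr; apply: ler_sum => j _.
  have /andP[h _] := cc _ (node_in_itv LU' (ltn_ord j)).
  apply: le_trans (ler_wpM2r (F0 j) h) _.
  have := row_bound j; rewrite ler_norml -/w => /andP[+ _].
  by rewrite -/(Mhat _) -/(Mcheck _) mulrBl; lra.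
- rewrite mulr_sumr; apply: ler_sum => j _.
  have /andP[_ h] := ch _ (node_in_itv LU' (ltn_ord j)).
  apply: le_trans _ (ler_wpM2r (F0 j) h).
  have := row_bound j; rewrite ler_norml -/w => /andP[_].
  by rewrite -/(Mhat _) -/(Mcheck _) mulrDl; lra.
Qed.

Lemma eta_ge0 (T h gamma : R) N : 0 < T -> 0 <= Defs.eta T N h gamma.
Proof.
move=> T0; apply: divr_ge0; first by rewrite divr_ge0// ltW.
by rewrite mulr_ge0// powR_ge0.
Qed.

Lemma samples_scale (xL xR yL yR nu : R) M1 M2 (a d : R -> R -> R) :
  xL < xR -> yL < yR ->
  (forall x y, x \in `]xL, xR[ -> y \in `]yL, yR[ -> d x y = nu * a x y) ->
  samples xL xR yL yR M1 M2 d = nu *: samples xL xR yL yR M1 M2 a.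
Proof.
move=> hx hy hd; apply/rowP => k; rewrite !mxE hd //; exact: node_in_itv.
Qed.

Lemma mean_scale n (c : R) (v : 'rV[R]_n) : mean (c *: v) = c * mean v.
Proof.
by rewrite /mean mulrA mulr_sumr; congr (_ / _); apply: eq_bigr => k _; rewrite mxE.
Qed.

Lemma mean_bounds n (v : 'rV[R]_n) lo hi : (0 < n)%N ->
  (forall k, lo <= v 0 k <= hi) -> lo <= mean v <= hi.
Proof.
move=> n0 vb; rewrite /mean ler_pdivlMr ?ltr0n// ler_pdivrMr ?ltr0n//.
have cst_sum (c : R) : c * n%:R = \sum_(k < n) c.
  by rewrite sumr_const card_ord mulr_natr.
by rewrite !cst_sum; apply/andP; split; apply: ler_sum => k _; have /andP[] := vb k.
Qed.

End TensorForms.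

Theorem theorem3p3 (R : realType) (alpha beta xL xR yL yR T nu1 nu2 : R)
  (a_check a_hat : R) (a d e : R -> R -> R) (Mt1 Mt2 : R -> R)
  (halpha : 1 < alpha < 2) (hbeta : 1 < beta < 2)
  (hx : xL < xR) (hy : yL < yR) (hT : 0 < T)
  (hnu1 : 0 <= nu1) (hnu2 : 0 <= nu2)
  (hd : forall x y, x \in `]xL, xR[ -> y \in `]yL, yR[ -> d x y = nu1 * a x y)
  (he : forall x y, x \in `]xL, xR[ -> y \in `]yL, yR[ -> e x y = nu2 * a x y)
  (ha_check : 0 < a_check)
  (ha : forall x y, x \in `]xL, xR[ -> y \in `]yL, yR[ ->
     a x y \in `[a_check, a_hat])
  (hconv_y : forall x, x \in `]xL, xR[ ->
     convex_on yL yR (fun y => a x y) \/ concave_on yL yR (fun y => a x y))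
  (hconv_x : forall y, y \in `]yL, yR[ ->
     convex_on xL xR (fun x => a x y) \/ concave_on xL xR (fun x => a x y))
  (hMt1 : forall y, y \in `]yL, yR[ ->
     is_Mtilde xL xR (fun x => a x y) (Mt1 y))
  (hMt2 : forall x, x \in `]xL, xR[ ->
     is_Mtilde yL yR (fun y => a x y) (Mt2 x)) :
  let Mhat1 y := sup_on xL xR (fun x => a x y) in
  let Mcheck1 y := inf_on xL xR (fun x => a x y) in
  let Mhat2 x := sup_on yL yR (fun y => a x y) in
  let Mcheck2 x := inf_on yL yR (fun y => a x y) in
  let c_check1 := c_check yL yR (varsigma alpha) Mt1 Mhat1 Mcheck1 in
  let c_check2 := c_check xL xR (varsigma beta) Mt2 Mhat2 Mcheck2 in
  let c_hat1 := c_hat yL yR (varsigma alpha) Mt1 Mhat1 Mcheck1 in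
  let c_hat2 := c_hat xL xR (varsigma beta) Mt2 Mhat2 Mcheck2 in
  let s_check := Num.min (Num.min (c_check1 / a_hat) (c_check2 / a_hat))
                         (a_check ^+ 2 / a_hat ^+ 2) in
  let s_hat := Num.max (Num.max (c_hat1 / a_check) (c_hat2 / a_check))
                       (a_hat ^+ 2 / a_check ^+ 2) in
  let A N M1 M2 := A_mx alpha beta xL xR yL yR T d e N M1 M2 in
  let P N M1 M2 := P_mx alpha beta xL xR yL yR T d e N M1 M2 in
  0 < c_check1 -> 0 < c_check2 ->
  [/\ 0 < s_check,
      0 < s_hat,
      (forall N M1 M2 : nat, (0 < N)%N -> (0 < M1)%N -> (0 < M2)%N ->
         P N M1 M2 \in unitmx /\
         sq_singular_values (A N M1 M2 *m invmx (P N M1 M2))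
           `<=` `[s_check, s_hat]) &
      (ereal_sup [set c | exists N M1 M2 : nat,
           [/\ (0 < N)%N, (0 < M1)%N, (0 < M2)%N &
               c = cond2 (A N M1 M2 *m invmx (P N M1 M2))]]
         <= (Num.sqrt (s_hat / s_check))%:E)%E].

Proof.
move=> Mhat1 Mcheck1 Mhat2 Mcheck2 c1 c2 C1 C2 s_check s_hat A P c1_gt0 c2_gt0.
have ab x y : x \in `]xL, xR[ -> y \in `]yL, yR[ -> a_check <= a x y <= a_hat.
  by move=> xin yin; have := ha x y xin yin; rewrite in_itv.
have ah0 : 0 < a_hat.
  have xin : (xL + xR) / 2 \in `]xL, xR[ by rewrite in_itv /=; apply/andP; split; lra.
  have yin : (yL + yR) / 2 \in `]yL, yR[ by rewrite in_itv /=; apply/andP; split; lra.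
  by have /andP[h1 h2] := ab _ _ xin yin; lra.
have s_check_gt0 : 0 < s_check.
  by rewrite !lt_min !divr_gt0// exprn_gt0.
have s_hat_gt0 : 0 < s_hat.
  by rewrite !lt_max (divr_gt0 (exprn_gt0 2 ah0) (exprn_gt0 2 ha_check)) orbT.
have main N M1 M2 : (0 < N)%N -> (0 < M1)%N -> (0 < M2)%N ->
    P N M1 M2 \in unitmx /\ forall x : 'cV_(M2 * M1), s_check * dot x x <=
      dot (A N M1 M2 *m invmx (P N M1 M2) *m x) (A N M1 M2 *m invmx (P N M1 M2) *m x)
      <= s_hat * dot x x.
  move=> N0 M10 M20.
  pose S := samples xL xR yL yR M1 M2 a.
  pose Bx := Bx_mx alpha xL xR T N M1 M2.
  pose By := By_mx beta yL yR T N M1 M2.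
  pose K := nu1 *: Bx + nu2 *: By.
  have Sb k : a_check <= S 0 k <= a_hat by rewrite mxE ab// node_in_itv.
  have PE : P N M1 M2 = 1%:M + mean S *: K.
    rewrite /P /P_mx (samples_scale _ _ hx hy hd) (samples_scale _ _ hx hy he) !mean_scale.
    by rewrite -/S -/Bx -/By scalerDr !scalerA !(mulrC (mean S)) addrA.
  have AE : A N M1 M2 = 1%:M + diag_mx S *m K.
    rewrite /A /A_mx (samples_scale _ _ hx hy hd) (samples_scale _ _ hx hy he).
    by rewrite -/S -/Bx -/By mulmxDr -!scalemxAr !linearZ /= -!scalemxAl addrA.
  rewrite PE AE.
  have e1 := eta_ge0 (mesh xL xR M1) alpha N hT.
  have e2 := eta_ge0 (mesh yL yR M2) beta N hT.
  have dot_diag1 (B : 'M[R]_(M2 * M1)) u : dot u (B *m u) =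
      dot u (diag_mx (const_mx 1) *m (B *m u)).
    by rewrite diag_const_mx mul1mx.
  have xb u : [/\ 0 <= dot u (Bx *m u),
      c1 * dot u (Bx *m u) <= dot u (diag_mx S *m (Bx *m u)) &
      dot u (diag_mx S *m (Bx *m u)) <= C1 * dot u (Bx *m u)].
    have [f0 lo hi] := direction_bounds (fun j i => u (mxtens_index (j, i)) 0)
      halpha hx hy (fun y x yin xin => ab x y xin yin) hMt1.
    set form := \sum_(j < M2) _ in f0 lo hi; set weighted := \sum_(j < M2) _ in lo hi.
    have -> : dot u (diag_mx S *m (Bx *m u)) =
        Defs.eta T N (mesh xL xR M1) alpha * weighted.
      rewrite /Bx /Bx_mx -scalemxAl -scalemxAr dotZr x_direction_form mulNr -mulrN -sumrN.
      congr (_ * _); apply: eq_bigr => j _; congr (- toeplitz_form _ _ _).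
      by apply/funext => i; rewrite mxE mxtens_indexK.
    have -> : dot u (Bx *m u) = Defs.eta T N (mesh xL xR M1) alpha * form.
      rewrite dot_diag1 /Bx /Bx_mx -scalemxAl -scalemxAr dotZr x_direction_form.
      rewrite mulNr -mulrN -sumrN.
      congr (_ * _); apply: eq_bigr => j _; congr (- toeplitz_form _ _ _).
      by apply/funext => i; rewrite mxE mul1r.
    by split; [rewrite mulr_ge0|rewrite mulrCA ler_wpM2l|rewrite mulrCA ler_wpM2l].
  have yb u : [/\ 0 <= dot u (By *m u),
      c2 * dot u (By *m u) <= dot u (diag_mx S *m (By *m u)) &
      dot u (diag_mx S *m (By *m u)) <= C2 * dot u (By *m u)].
    have [f0 lo hi] := direction_bounds (fun i j => u (mxtens_index (j, i)) 0)
      hbeta hy hx ab hMt2.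
    set form := \sum_(i < M1) _ in f0 lo hi; set weighted := \sum_(i < M1) _ in lo hi.
    have -> : dot u (diag_mx S *m (By *m u)) =
        Defs.eta T N (mesh yL yR M2) beta * weighted.
      rewrite /By /By_mx -scalemxAl -scalemxAr dotZr y_direction_form mulNr -mulrN -sumrN.
      congr (_ * _); apply: eq_bigr => i _; congr (- toeplitz_form _ _ _).
      by apply/funext => j; rewrite mxE mxtens_indexK.
    have -> : dot u (By *m u) = Defs.eta T N (mesh yL yR M2) beta * form.
      rewrite dot_diag1 /By /By_mx -scalemxAl -scalemxAr dotZr y_direction_form.
      rewrite mulNr -mulrN -sumrN.
      congr (_ * _); apply: eq_bigr => i _; congr (- toeplitz_form _ _ _).
      by apply/funext => j; rewrite mxE mul1r.
    by split; [rewrite mulr_ge0|rewrite mulrCA ler_wpM2l|rewrite mulrCA ler_wpM2l].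
  have KE u : dot u (K *m u) = nu1 * dot u (Bx *m u) + nu2 * dot u (By *m u).
    by rewrite mulmxDl dotDr -!scalemxAl !dotZr.
  have SKE u : dot u (diag_mx S *m (K *m u)) =
      nu1 * dot u (diag_mx S *m (Bx *m u)) + nu2 * dot u (diag_mx S *m (By *m u)).
    by rewrite mulmxDl mulmxDr dotDr -!scalemxAl -!scalemxAr !dotZr.
  apply: (@diag_dominated_bounds R _ S K a_check a_hat _
    (Num.min c1 c2) (Num.max C1 C2)) => //.
  - by apply: mean_bounds => //; rewrite muln_gt0 M20.
  - by move=> u; have [h1 _ _] := xb u; have [h2 _ _] := yb u; rewrite KE addr_ge0// mulr_ge0.
  - move=> u; have [h1 h3 h5] := xb u; have [h2 h4 h6] := yb u; rewrite KE SKE.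
    rewrite !mulrDr; apply/andP; split; apply: lerD; rewrite mulrCA ler_wpM2l//.
    + by apply: le_trans h3; rewrite ler_wpM2r// ge_min lexx.
    + by apply: le_trans h4; rewrite ler_wpM2r// ge_min lexx orbT.
    + by apply: le_trans h5 _; rewrite ler_wpM2r// le_max lexx.
    + by apply: le_trans h6 _; rewrite ler_wpM2r// le_max lexx orbT.
  - rewrite ler_pdivlMr// le_min -!ler_pdivlMr//.
    by rewrite !ge_min !lexx !orbT.
  - by rewrite ge_min lexx orbT.
  - rewrite ler_pdivrMr// ge_max -!ler_pdivrMr//.
    by rewrite !le_max !lexx !orbT.
  - by rewrite le_max lexx orbT.
split=> //.
- move=> N M1 M2 N0 M10 M20; have [Pu Cb] := main N M1 M2 N0 M10 M20.
  by split=> //; exact: two_sided_singular_values Cb.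
- apply: ge_ereal_sup => _ [N [M1 [M2 [N0 M10 M20 ->]]]].
  have [_ Cb] := main N M1 M2 N0 M10 M20.
  by apply: two_sided_cond2 => //; exact: ltW.
Qed.
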